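(* Let $m>0$. For every causal kernel $K$ on $\mathbb{R}^3$ one has $|K(k,p)|\le K_{3/2}(k,p)$ for all $k,p\in\mathbb{R}^3$, where $$K_{3/2}(k,p)=\frac{\epsilon(k)+\epsilon(p)}{2\sqrt{\epsilon(k)\epsilon(p)}}\left(\frac{2m^2}{m^2+\epsilon(k)\epsilon(p)-kp}\right)^{3/2}.$$
   Context: For $m>0$ put $\epsilon(p)=\sqrt{m^2+|p|^2}$ for $p\in\mathbb{R}^3$; $kp$ denotes the Euclidean scalar product of $k,p\in\mathbb{R}^3$. A kernel $K:X\times X\to\mathbb{C}$ is positive definite if $\sum_{i,j}\overline{c_i}c_jK(x_i,x_j)\ge 0$ for all finite families $x_i\in X$, $c_i\in\mathbb{C}$. A causal kernel is a positive definite kernel on $\mathbb{R}^3$ of the form $$K(k,p)=\frac{\epsilon(k)+\epsilon(p)}{2\sqrt{\epsilon(k)\epsilon(p)}}\,g\big(\epsilon(k)\epsilon(p)-kp\big)$$ with $g:[m^2,\infty[\to\mathbb{R}$ continuous and $g(m^2)=1$. *)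

(* Defs.v *)
From HB Require Import structures.
From mathcomp Require Import all_boot all_order all_algebra.
From mathcomp Require Import all_classical all_reals all_analysis.
From mathcomp Require Import complex.
Set Implicit Arguments.
Unset Strict Implicit.
Unset Printing Implicit Defensive.
Import Order.TTheory GRing.Theory Num.Theory.
Import numFieldNormedType.Exports.
Local Open Scope classical_set_scope.
Local Open Scope ring_scope.
Local Open Scope complex_scope.

(* Euclidean scalar product on R^3; the library's norm `|p| on 'rV[R]_3 is the
   sup norm, so |p|^2 is written dot3 p p. *)
Definition dot3 {R : realType} (k p : 'rV[R]_3) : R :=
  \sum_(i < 3) k ord0 i * p ord0 i.

Definition energy {R : realType} (m : R) (p : 'rV[R]_3) : R :=
  Num.sqrt (m ^+ 2 + dot3 p p).

(* The order of R[i] is partial: 0 <= z says that z is real and nonnegative. *)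
Definition positive_definite {R : realType} (X : Type) (K : X -> X -> R[i]) :
    Prop :=
  forall (n : nat) (x : 'I_n -> X) (c : 'I_n -> R[i]),
    0 <= \sum_(i < n) \sum_(j < n) (c i)^*%C * c j * K (x i) (x j).

Definition energy_factor {R : realType} (m : R) (k p : 'rV[R]_3) : R :=
  (energy m k + energy m p) / (2 * Num.sqrt (energy m k * energy m p)).

(* This is always >= m^2 (reversed Cauchy-Schwarz inequality), so only the
   restriction to [m^2, +oo[ of the function g below matters. *)
Definition mink {R : realType} (m : R) (k p : 'rV[R]_3) : R :=
  energy m k * energy m p - dot3 k p.

Definition causal_kernel {R : realType} (m : R)
    (K : 'rV[R]_3 -> 'rV[R]_3 -> R[i]) : Prop :=
  positive_definite K /\
  exists g : R -> R,
    [/\ {within `[m ^+ 2, +oo[, continuous g},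
        g (m ^+ 2) = 1 &
        forall k p, K k p = (energy_factor m k p * g (mink m k p))%:C].

Definition K32 {R : realType} (m : R) (k p : 'rV[R]_3) : R :=
  energy_factor m k p *
  ((2 * m ^+ 2) / (m ^+ 2 + mink m k p)) `^ (3 / 2).

(* Main.v *)
Require Import Defs.
From HB Require Import structures.
From mathcomp Require Import all_boot all_order all_algebra.
From mathcomp Require Import all_classical all_reals all_analysis.
From mathcomp Require Import complex.
From mathcomp Require Import ring lra.
Import Order.TTheory GRing.Theory Num.Theory.
Import numFieldNormedType.Exports.
Local Open Scope ring_scope.
Local Open Scope complex_scope.

(** Put phi(t) = g(m^2 t) and let G be its antiderivative vanishing at 1. Averaging the
    positive definite kernel (e_k + e_p) phi(e_k e_p - k.p) over spheres of radius sinh s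
    and energy cosh s gives, with H(s) = G(cosh s), the positive definite kernel
      (cosh s + cosh s') (H(s + s') - H(s - s')).
    Apply it to three equidistant shells tending to infinity, with coefficients for which
    the terms H(s + s') cannot stay above a positive constant (H >= 0 grows at most like
    e^(s/2)); the terms H(s - s') then give
      H(2h) cosh h <= 2 (1 + cosh (h/2)) cosh (h/2) H(h).
    Since the function 4 (cosh (h/2) - 1) / cosh (h/2) turns this into an equality and has
    the same second order behaviour at 0 as H, it dominates H. The Cauchy-Schwarz inequality
    between the origin and one shell then bounds phi(cosh s)^2 by H(2s), hence
    phi(t)^2 <= (2 / (1 + t))^3. *)

(** Two single momenta only give phi(t) <= 2 sqrt(t) / (1 + t); the decay of order 3/2 needs whole
    spheres. Positive definiteness speaks of finite families, so the spherical mean is taken as a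
    limit of finite means; hence the equidistribution theorem below, proved for monomials and
    extended by Weierstrass approximation. The three coefficients are those of p(X) = (X - 1)(X -
    rho). With q = e^(h/2) the terms H(s + s') form, to leading order, a linear recurrence with
    symbol p(X) p(q^2 X), whose roots are 1, rho, q^-2 and rho q^-2. The a priori growth e^(s/2) of
    H is the rate q, so any rho > q is excluded as a mode. The terms H(s - s') give, after division
    by rho, the factor (1 + rho)(rho + q^2) / rho = 1 + q^2 + rho + q^2 / rho, which is smallest at
    rho = q: the weak growth bound reaches exactly the optimal value as a limit. The comparison
    function 4 (cosh (h/2) - 1) / cosh (h/2) is the integral of (2 / (1 + t))^(3/2) from 1 to cosh
    h, that is, the function H of the extremal kernel. *)

(** * Weierstrass approximation by Bernstein polynomials *)

Lemma uniform_continuity_itv01 {R : realType} (f : R -> R) (e : R) :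
  continuous f -> 0 < e ->
  exists2 d : R, 0 < d & forall x y : R, 0 <= x <= 1 -> `|y - x| < d ->
    `|f y - f x| < e.
Proof.
move=> fc e0.
have := @segment_compact R 0 1.
move=> /compact_near_coveringP.
(* Compactness in its near-covering form, with the modulus [d] as the parameter tending to 0 from
   the right. *)
move=> /(_ R (0^'+)%classic (fun d x => forall y, `|y - x| < d -> `|f y - f x| < e)).
case.
- move=> z _; pose x : R := z; rewrite -[z]/x; clearbody x; clear z.
  have /cvgrPdist_lt /(_ (e / 2)) := fc x.
  rewrite divr_gt0// => /(_ isT) /nbhs_ballP[r /= r0 hr].
  exists (ball x (r / 2), [set d | d < r / 2])%classic => /=.
    split.
      by apply: nbhsx_ballx; rewrite divr_gt0.
    by apply: nbhs_right_lt; rewrite divr_gt0.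
  have {}hr : forall z : R, `|x - z| < r -> `|f x - f z| < e / 2.
    by move=> z h; exact: hr.
  have {}r0 : (0 : R) < r by exact: r0.
  have main : forall x' d y : R, `|x - x'| < r / 2 -> d < r / 2 ->
      `|y - x'| < d -> `|f y - f x'| < e.
    move=> x' d y xx' dr yx'.
    have h1 : `|f x - f x'| < e / 2 by apply: hr; lra.
    have h2 : `|f x - f y| < e / 2.
      by apply: hr; have := ler_distD x' x y; rewrite (distrC x' y) => h'; lra.
    by have := ler_distD (f x) (f y) (f x'); rewrite (distrC (f y) (f x)) => h'; lra.
  by move=> [x' d] /= [xx' dr] y; exact: main.
- move=> d0 /= d0_gt0 h.
  exists (d0 / 2); first by rewrite divr_gt0.
  move=> x y x01; apply: (h (d0 / 2)).
  + rewrite /= sub0r normrN gtr0_norm ?divr_gt0//; lra.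
  + by rewrite divr_gt0.
  + by rewrite /= in_itv.
Qed.

(** The binomial law with parameters [n] and [x]; the sums that follow are its mass, mean, second
    moment and rescaled variance. *)
Definition bern {R : realType} (n k : nat) (x : R) : R :=
  x ^+ k * (1 - x) ^+ (n - k) *+ 'C(n, k).

Lemma bern_ge0 {R : realType} n k (x : R) : 0 <= x <= 1 -> 0 <= bern n k x.
Proof.
move=> /andP[x0 x1]; rewrite mulrn_wge0// mulr_ge0// exprn_ge0//; lra.
Qed.

Lemma sum_bern {R : realType} n (x : R) : \sum_(k < n.+1) bern n k x = 1.
Proof.
have := exprDn (1 - x) x n; rewrite subrK expr1n => ->.
by apply: eq_bigr => k _; rewrite /bern mulrC.
Qed.

Lemma sum_bern1 {R : realType} n (x : R) :
  \sum_(k < n.+1) k%:R * bern n k x = n%:R * x.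
Proof.
case: n => [|n]; first by rewrite big_ord1 !mul0r.
rewrite big_ord_recl mul0r add0r /=.
transitivity (n.+1%:R * x * \sum_(k < n.+1) bern n k x); last by rewrite sum_bern mulr1.
rewrite mulr_sumr; apply: eq_bigr => k _.
rewrite /bern /bump /= add1n subSS.
rewrite -[_ *+ 'C(n.+1, _)]mulr_natr -[_ *+ 'C(n, _)]mulr_natr.
have := mul_bin_diag n.+1 k => /= /(congr1 (fun m => m%:R : R)).
rewrite !natrM => h.
transitivity (x * x ^+ k * (1 - x) ^+ (n - k) * (k.+1%:R * 'C(n.+1, k.+1)%:R)).
  by rewrite [x ^+ k.+1]exprS; ring.
by rewrite -h; ring.
Qed.

Lemma sum_bern2 {R : realType} n (x : R) :
  \sum_(k < n.+1) k%:R ^+ 2 * bern n k x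
  = n%:R * x + n%:R * (n%:R - 1) * x ^+ 2.
Proof.
case: n => [|n]; first by rewrite big_ord1 expr0n /= !mul0r addr0.
rewrite big_ord_recl expr0n mul0r add0r /=.
transitivity (n.+1%:R * x * \sum_(k < n.+1) (k%:R * bern n k x + bern n k x)).
  rewrite mulr_sumr; apply: eq_bigr => k _.
  rewrite /bern /bump /= add1n subSS.
  rewrite -[_ *+ 'C(n.+1, _)]mulr_natr -[_ *+ 'C(n, _)]mulr_natr.
  have := mul_bin_diag n.+1 k => /= /(congr1 (fun m => m%:R : R)).
  rewrite !natrM => h.
  transitivity (k.+1%:R * x * x ^+ k * (1 - x) ^+ (n - k) * (k.+1%:R * 'C(n.+1, k.+1)%:R)).
    by rewrite [x ^+ k.+1]exprS; ring.
  rewrite -h -[k.+1%:R]natr1; ring.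
by rewrite big_split /= sum_bern1 sum_bern -natr1; ring.
Qed.

Lemma bern_variance {R : realType} n (x : R) : (0 < n)%N ->
  \sum_(k < n.+1) (k%:R / n%:R - x) ^+ 2 * bern n k x = x * (1 - x) / n%:R.
Proof.
move=> n0; have n0' : (n%:R : R) != 0 by rewrite pnatr_eq0 -lt0n.
transitivity (n%:R ^- 2 * \sum_(k < n.+1) k%:R ^+ 2 * bern n k x
  - 2 * x / n%:R * \sum_(k < n.+1) k%:R * bern n k x
  + x ^+ 2 * \sum_(k < n.+1) bern n k x).
  rewrite !mulr_sumr -sumrB -big_split /=; apply: eq_bigr => k _; field.
  exact: n0'.
by rewrite sum_bern sum_bern1 sum_bern2; field.
Qed.

Lemma weierstrass01 {R : realType} (f : R -> R) (e : R) :
  continuous f -> 0 < e ->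
  exists p : {poly R}, forall x : R, 0 <= x <= 1 -> `|f x - p.[x]| <= e.
Proof.
move=> fc e0.
have [M fM] : exists M : R, forall x : R, 0 <= x <= 1 -> `|f x| <= M.
  have h : {within `[(0 : R), 1], continuous (fun x => `|f x|)}%classic.
    apply: continuous_subspaceT => x.
    by apply: (@continuous_comp _ _ _ f (fun z => `|z|)); [exact: fc|exact: norm_continuous].
  have [c _ hc] := @EVT_max R _ 0 1 ler01 h.
  by exists `|f c| => x x01; apply: hc; rewrite in_itv.
have M0 : 0 <= M by apply: le_trans (fM 0 _); rewrite ?normr_ge0// lexx ler01.
have [d d0 fd] := uniform_continuity_itv01 f (e / 2) fc (divr_gt0 e0 (ltr0Sn R 1)).
(* The rescaled variance is at most [1 / n], so this [n] makes the Chebyshev term at most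
   [e / 2]. *)
have [n n0 hn] : exists2 n, (0 < n)%N & 2 * M / d ^+ 2 / n%:R <= e / 2.
  pose c := 2 * M / d ^+ 2 / (e / 2).
  exists (Num.truncn c).+1 => //.
  rewrite ler_pdivrMr ?ltr0Sn// [leRHS]mulrC -ler_pdivrMr ?divr_gt0//.
  by apply: ltW; exact: truncnS_gt.
exists (\sum_(k < n.+1) f (k%:R / n%:R) *: ('X ^+ k * (1 - 'X) ^+ (n - k) *+ 'C(n, k))).
move=> x x01.
have -> : (\sum_(k < n.+1) f (k%:R / n%:R) *: ('X ^+ k * (1 - 'X) ^+ (n - k) *+ 'C(n, k))).[x]
  = \sum_(k < n.+1) f (k%:R / n%:R) * bern n k x.
  rewrite horner_sum; apply: eq_bigr => k _.
  by rewrite hornerZ hornerMn hornerM !horner_exp !hornerE /bern.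
have -> : f x = \sum_(k < n.+1) f x * bern n k x by rewrite -mulr_sumr sum_bern mulr1.
rewrite -sumrB.
(* near the node use uniform continuity, away from it the variance *)
apply: (@le_trans _ _ (\sum_(k < n.+1) (e / 2 + 2 * M / d ^+ 2 * (k%:R / n%:R - x) ^+ 2) * bern n k x)).
  apply: le_trans (ler_norm_sum _ _ _) _; apply: ler_sum => k _.
  rewrite -mulrBl normrM (ger0_norm (bern_ge0 _ _ _ x01)).
  apply: ler_wpM2r; first exact: bern_ge0.
  have [kd|kd] := ltP `|k%:R / n%:R - x| d.
    have /ltW := fd _ _ x01 kd; rewrite distrC => h.
    have : 0 <= 2 * M / d ^+ 2 * (k%:R / n%:R - x) ^+ 2.
      by rewrite mulr_ge0 ?sqr_ge0// divr_ge0 ?sqr_ge0// mulr_ge0.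
    lra.
  have hk : 0 <= (k%:R / n%:R : R) <= 1.
    rewrite divr_ge0//= ler_pdivrMr ?ltr0n// mul1r ler_nat -ltnS; exact: ltn_ord.
  have h1 : d ^+ 2 <= (k%:R / n%:R - x) ^+ 2.
    by rewrite -[leRHS]real_normK ?num_real// lerXn2r// nnegrE ltW.
  have h2 : 2 * M <= 2 * M / d ^+ 2 * (k%:R / n%:R - x) ^+ 2.
    rewrite mulrAC ler_pdivlMr ?exprn_gt0//.
    by apply: ler_wpM2l => //; rewrite mulr_ge0.
  have := ler_normB (f x) (f (k%:R / n%:R)).
  have := fM _ x01; have := fM _ hk.
  lra.
under eq_bigr do rewrite mulrDl -[X in _ + X]mulrA.
rewrite big_split /= -!mulr_sumr sum_bern bern_variance//.
have h : 2 * M / d ^+ 2 * (x * (1 - x) / n%:R) <= 2 * M / d ^+ 2 / n%:R.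
  rewrite mulrA ler_wpM2r ?invr_ge0// ler_piMr//.
    by rewrite divr_ge0 ?sqr_ge0// mulr_ge0.
  case/andP: x01 => x0 x1.
  by rewrite -[leRHS]mulr1; apply: ler_pM => //; lra.
lra.
Qed.

Lemma weierstrass {R : realType} (f : R -> R) (e : R) :
  continuous f -> 0 < e ->
  exists p : {poly R}, forall x : R, -1 <= x <= 1 -> `|f x - p.[x]| <= e.
Proof.
move=> fc e0.
have [|p hp] := weierstrass01 (fun x => f (2 * x - 1)) e _ e0.
  move=> x; apply: (@continuous_comp _ _ _ (fun x : R => 2 * x - 1) f); last exact: fc.
  by apply: cvgB; [apply: cvgM; [exact: cvg_cst|exact: cvg_id]|exact: cvg_cst].
exists (p \Po (2^-1 *: ('X + 1))) => x x1.
have := hp (2^-1 * (x + 1)).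
have -> : 2 * (2^-1 * (x + 1)) - 1 = x by lra.
by rewrite horner_comp !hornerE; apply; apply/andP; split; lra.
Qed.

(** * Moments of equally spaced heights *)

Definition avg {R : realType} (N : nat) (F : nat -> R) : R :=
  (\sum_(i < N.+1) F i) / N.+1%:R.

Lemma avgB {R : realType} N (F G : nat -> R) :
  avg N (fun i => F i - G i) = avg N F - avg N G.
Proof. by rewrite /avg sumrB mulrBl. Qed.

Lemma avgZ {R : realType} N (c : R) (F : nat -> R) :
  avg N (fun i => c * F i) = c * avg N F.
Proof. by rewrite /avg -mulr_sumr mulrA. Qed.

Lemma avg_cst {R : realType} N (c : R) : avg N (fun=> c) = c.
Proof.
by rewrite /avg sumr_const card_ord -[c *+ _]mulr_natr mulfK ?pnatr_eq0.
Qed.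

Lemma eq_avg {R : realType} N (F G : nat -> R) :
  (forall i : 'I_N.+1, F i = G i) -> avg N F = avg N G.
Proof. by move=> h; rewrite /avg; congr (_ / _); apply: eq_bigr. Qed.

Lemma avg_sum {R : realType} N n (F : nat -> nat -> R) :
  avg N (fun i => \sum_(k < n) F k i) = \sum_(k < n) avg N (F k).
Proof. by rewrite /avg exchange_big /= mulr_suml. Qed.

Lemma cvg_le_harmonic {R : realType} (u : nat -> R) (l K : R) :
  (forall N, `|u N - l| <= K / N.+1%:R) -> (u @ \oo --> l)%classic.
Proof.
move=> h; apply/cvgrPdist_le => e e0.
have hK : ((fun N => K * harmonic N) @ \oo --> K * 0)%classic.
  by apply: cvgM; [exact: cvg_cst|exact: cvg_harmonic].
move: hK; rewrite mulr0 => /cvgrPdist_le /(_ e e0).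
apply: filterS => N; rewrite sub0r normrN => hN.
by rewrite distrC (le_trans (h N))// (le_trans (ler_norm _)).
Qed.

(** Left endpoints of [N.+1] equal cells of [-1, 1]. The extra index [N.+1] gives the right end 1,
    which closes the telescoping sums. *)
Definition znode {R : realType} (N i : nat) : R := 2 * i%:R / N.+1%:R - 1.

Lemma znode_itv {R : realType} N i : (i <= N.+1)%N -> -1 <= (znode N i : R) <= 1.
Proof.
move=> iN; have : (i%:R / N.+1%:R : R) <= 1.
  by rewrite ler_pdivrMr ?ltr0n// mul1r ler_nat.
have : 0 <= (i%:R / N.+1%:R : R) by rewrite divr_ge0.
by rewrite /znode -mulrA; set t := _ / _ => h0 h1; apply/andP; split; lra.
Qed.

(** The step of the induction multiplies the remainder by [b] and adds n + 1 times (b - a)^2 a^n;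
    the crude constant survives because n^2 + n + 1 <= (n + 1)^2. *)
Lemma expr_taylor1 {R : realType} (a b : R) n : `|a| <= 1 -> `|b| <= 1 ->
  `|b ^+ n.+1 - a ^+ n.+1 - n.+1%:R * (b - a) * a ^+ n|
  <= n%:R ^+ 2 * (b - a) ^+ 2.
Proof.
move=> a1 b1; elim: n => [|n IH].
  by rewrite !expr1 expr0 !mulr1 mul1r subrr normr0 expr0n mul0r.
have -> : b ^+ n.+2 - a ^+ n.+2 - n.+2%:R * (b - a) * a ^+ n.+1
  = b * (b ^+ n.+1 - a ^+ n.+1 - n.+1%:R * (b - a) * a ^+ n)
    + n.+1%:R * ((b - a) ^+ 2 * a ^+ n).
  rewrite -(natr1 n.+1) !(exprS b n.+1) !(exprS a n.+1) !(exprS a n); ring.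
apply: le_trans (ler_normD _ _) _.
have h1 : `|b * (b ^+ n.+1 - a ^+ n.+1 - n.+1%:R * (b - a) * a ^+ n)|
   <= n%:R ^+ 2 * (b - a) ^+ 2.
  by rewrite normrM (le_trans _ IH)// ler_piMl.
have h2 : `|n.+1%:R * ((b - a) ^+ 2 * a ^+ n)| <= n.+1%:R * (b - a) ^+ 2.
  rewrite normrM ger0_norm// ler_wpM2l// normrM ger0_norm ?sqr_ge0//.
  by rewrite ler_piMr ?sqr_ge0// normrX exprn_ile1.
apply: le_trans (lerD h1 h2) _.
rewrite -mulrDl ler_wpM2r ?sqr_ge0// -natr1.
have : 0 <= (n%:R : R) by []. nra.
Qed.

(** On each cell the term is compared with the exact increment of z^(j+1) / (j+1). The increments
    telescope, and N + 1 quadratic remainders add up to O(1/N). *)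
Lemma cvg_znode_moment {R : realType} j :
  ((fun N => avg N (fun i => (znode N i : R) ^+ j)) @ \oo -->
   ((1 - (-1) ^+ j.+1) / (2 * j.+1%:R) : R))%classic.
Proof.
apply: (@cvg_le_harmonic _ _ _ (2 * j%:R ^+ 2)) => N.
have N0 : (N.+1%:R : R) != 0 by rewrite pnatr_eq0.
have j0 : (j.+1%:R : R) != 0 by rewrite pnatr_eq0.
pose z i : R := znode N i.
have dz i : z i.+1 - z i = 2 / N.+1%:R.
  by rewrite /z /znode -(natr1 i); field; rewrite -(natr1 N) in N0.
have tel : (1 - (-1) ^+ j.+1 : R) = \sum_(i < N.+1) (z i.+1 ^+ j.+1 - z i ^+ j.+1).
  rewrite -(big_mkord xpredT (fun i => z i.+1 ^+ j.+1 - z i ^+ j.+1)) telescope_sumr//.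
  congr (_ - _).
    by rewrite /z /znode mulfK// (_ : 2 - 1 = 1 :> R) ?expr1n//; ring.
  by rewrite /z /znode mulr0 mul0r sub0r.
have -> : avg N (fun i => z i ^+ j) - (1 - (-1) ^+ j.+1) / (2 * j.+1%:R)
  = - (2 * j.+1%:R)^-1 * \sum_(i < N.+1)
     (z i.+1 ^+ j.+1 - z i ^+ j.+1 - j.+1%:R * (z i.+1 - z i) * z i ^+ j).
  rewrite sumrB -tel /avg.
  under [in RHS]eq_bigr do rewrite dz.
  by rewrite -mulr_sumr; field; rewrite !(addrC 1) !natr1 N0 j0.
have h0 : 0 <= (2 * j.+1%:R : R)^-1 by rewrite invr_ge0 mulr_ge0.
rewrite normrM normrN (ger0_norm h0).
have hs : `|\sum_(i < N.+1)
     (z i.+1 ^+ j.+1 - z i ^+ j.+1 - j.+1%:R * (z i.+1 - z i) * z i ^+ j)|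
   <= 4 * j%:R ^+ 2 / N.+1%:R.
  apply: le_trans (ler_norm_sum _ _ _) _.
  apply: (@le_trans _ _ (\sum_(i < N.+1) j%:R ^+ 2 * (2 / N.+1%:R) ^+ 2)).
    apply: ler_sum => i _; rewrite -(dz i); apply: expr_taylor1.
      by rewrite ler_norml znode_itv// ltnW// ltnS ltnW.
    by rewrite ler_norml znode_itv.
  rewrite sumr_const card_ord -mulr_natr le_eqVlt; apply/orP; left.
  by apply/eqP; field; rewrite !(addrC 1) !natr1 N0.
apply: le_trans (ler_wpM2l h0 hs) _.
rewrite mulrA ler_wpM2r ?invr_ge0// ler_pdivrMl ?mulr_gt0//.
have : 1 <= (j.+1%:R : R) by rewrite ler1n.
have : 0 <= (j%:R ^+ 2 : R) by rewrite sqr_ge0.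
set x := j%:R ^+ 2; set y := j.+1%:R; nra.
Qed.

(** * Means of powers of the cosine, and moments of z and 1 - z^2 *)

(** Multiplying by [2 * sin al], with [al] half the angular step, makes the sum telescope over a
    whole number of periods; 0 < l < N keeps [sin al] nonzero. *)
Lemma cos_sum0 {R : realType} (N l : nat) (tau : R) : (0 < l < N)%N ->
  \sum_(b < N) cos (l%:R * (tau + 2 * pi * b%:R / N%:R)) = 0.
Proof.
move=> /andP[l0 lN].
have N0 : (N%:R : R) != 0 by rewrite pnatr_eq0 -lt0n (leq_trans _ lN).
pose al : R := pi * l%:R / N%:R.
have sal : sin al != 0.
  rewrite gt_eqF// sin_gt0_pi// divr_gt0 ?mulr_gt0 ?pi_gt0 ?ltr0n//=; last first.
    by rewrite (leq_trans _ lN).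
  by rewrite ltr_pdivrMr ?ltr0n ?(leq_trans _ lN)// ltr_pM2l ?pi_gt0// ltr_nat.
apply: (mulfI (_ : 2 * sin al != 0)); first by rewrite mulf_neq0// pnatr_eq0.
rewrite mulr0 mulr_sumr.
pose S b := sin (l%:R * tau + 2 * al * b%:R - al).
transitivity (\sum_(b < N) (S b.+1 - S b)).
  apply: eq_bigr => b _; rewrite /S.
  have -> : l%:R * tau + 2 * al * b.+1%:R - al = (l%:R * tau + 2 * al * b%:R) + al.
    by rewrite -natr1; ring.
  have -> : l%:R * (tau + 2 * pi * b%:R / N%:R) = l%:R * tau + 2 * al * b%:R.
    by rewrite /al; field.
  by rewrite sinD sinB; ring.
rewrite -(big_mkord xpredT (fun b => S b.+1 - S b)) telescope_sumr// /S.
have -> : l%:R * tau + 2 * al * N%:R - al = (l%:R * tau - al) + pi *+ 2 *+ l.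
  by rewrite -[_ *+ l]mulr_natr -[pi *+ 2]mulr_natr /al; field.
by rewrite (periodicn (@sinD2pi R)) mulr0 addr0 subrr.
Qed.

(** Real form of the binomial expansion of (e^(ix) + e^(-ix))^k; the induction is Pascal's rule. *)
Lemma expr_cos {R : realType} k (x : R) :
  2 ^+ k * cos x ^+ k
  = \sum_(m < k.+1) 'C(k, m)%:R * cos ((k%:R - 2 * m%:R) * x).
Proof.
elim: k => [|k IH].
  by rewrite big_ord1 bin0 !expr0 mulr0 subrr mul0r cos0.
have -> : 2 ^+ k.+1 * cos x ^+ k.+1 = 2 * cos x * (2 ^+ k * cos x ^+ k).
  by rewrite !exprS; ring.
rewrite IH mulr_sumr.
pose c m : R := cos ((k.+1%:R - 2 * m%:R) * x).
transitivity (\sum_(m < k.+1) ('C(k, m)%:R * c m + 'C(k, m)%:R * c m.+1)).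
  apply: eq_bigr => m _; rewrite /c -(natr1 k) -(natr1 m).
  have -> : (k%:R + 1 - 2 * m%:R) * x = (k%:R - 2 * m%:R) * x + x by ring.
  have -> : (k%:R + 1 - 2 * (m%:R + 1)) * x = (k%:R - 2 * m%:R) * x - x by ring.
  by rewrite cosD cosB; ring.
rewrite big_split /= [in RHS]big_ord_recl /= bin0.
rewrite [in X in X + _ = _]big_ord_recl /= bin0 -addrA; congr (_ + _).
transitivity (\sum_(m < k.+1) ('C(k, m.+1)%:R * c m.+1 + 'C(k, m)%:R * c m.+1)).
  rewrite big_split /=; congr (_ + _).
  by rewrite big_ord_recr /= bin_small// mul0r addr0.
by apply: eq_bigr => m _; rewrite /bump /= add1n binS natrD mulrDl.
Qed.

(* The mean of cos^k over a period; it is attained exactly by more than k equally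
   spaced nodes (avg_cos_pow). *)
Definition cosmom {R : realType} (k : nat) : R :=
  (\sum_(m < k.+1) 'C(k, m)%:R * (k == m.*2)%:R) / 2 ^+ k.

Lemma cosmom_odd {R : realType} k : odd k -> cosmom k = 0 :> R.
Proof.
move=> ok; rewrite /cosmom big1 ?mul0r// => m _.
by case: eqP => [/(congr1 odd)|]; rewrite ?ok ?odd_double// mulr0.
Qed.

Lemma cosmom_even {R : realType} j : cosmom j.*2 = 'C(j.*2, j)%:R / 4 ^+ j :> R.
Proof.
rewrite /cosmom -[in 2 ^+ _]muln2 mulnC exprM; congr (_ / _ ^+ _); last by ring.
have jj : (j < j.*2.+1)%N by rewrite ltnS -addnn leq_addr.
rewrite (bigD1 (Ordinal jj))//= eqxx mulr1 big1 ?addr0// => m.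
rewrite -val_eqE /= (inj_eq double_inj) eq_sym => /negbTE ->.
by rewrite mulr0.
Qed.

(** All frequencies k - 2m have absolute value at most k < N + 1, so [cos_sum0] removes every one
    except 0. *)
Lemma avg_cos_pow {R : realType} (N k : nat) (tau : R) : (k < N.+1)%N ->
  avg N (fun b => cos (tau + 2 * pi * b%:R / N.+1%:R) ^+ k) = cosmom k.
Proof.
move=> kN; have N0 : (N.+1%:R : R) != 0 by rewrite pnatr_eq0.
apply: (mulfI (_ : 2 ^+ k != 0)); first by rewrite expf_neq0// pnatr_eq0.
rewrite /cosmom [RHS]mulrCA divff ?expf_neq0 ?pnatr_eq0// mulr1 -avgZ.
pose F m b := 'C(k, m)%:R * cos ((k%:R - 2 * m%:R) * (tau + 2 * pi * b%:R / N.+1%:R)).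
transitivity (avg N (fun b => \sum_(m < k.+1) F m b)).
  by apply: eq_avg => b; exact: expr_cos.
rewrite avg_sum; apply: eq_bigr => -[m mk] _ /=; rewrite ltnS in mk.
rewrite avgZ; congr (_ * _).
have [->|km] := eqVneq k m.*2.
  have -> : m.*2%:R - 2 * m%:R = 0 :> R by rewrite -muln2 natrM; ring.
  rewrite -[RHS](avg_cst N); apply: eq_avg => b; by rewrite mul0r cos0.
rewrite /avg.
have [mk2|mk2] := ltnP m.*2 k.
  have -> : k%:R - 2 * m%:R = (k - m.*2)%:R :> R.
    by rewrite (natrB _ (ltnW mk2)) -muln2 natrM mulrC.
  rewrite cos_sum0 ?mul0r//; rewrite subn_gt0 mk2/=.
  by rewrite (leq_ltn_trans (leq_subr _ _)).
have mk3 : (k < m.*2)%N by rewrite ltn_neqAle km.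
have -> : k%:R - 2 * m%:R = - (m.*2 - k)%:R :> R.
  by rewrite (natrB _ (ltnW mk3)) -muln2 natrM; ring.
under eq_bigr do rewrite mulNr cosN.
rewrite cos_sum0 ?mul0r// subn_gt0 mk3/= (leq_ltn_trans _ kN)//.
by rewrite leq_subLR -addnn leq_add.
Qed.

(* 1/2 \int_{-1}^1 z^{2a} (1 - z^2)^j dz *)
Definition beta_moment {R : realType} (a j : nat) : R :=
  (a.*2)`!%:R * j`!%:R * (a + j)`!%:R * 4 ^+ j / (a`!%:R * ((a + j).*2.+1)`!%:R).

Lemma fact_neq0R {R : realType} n : n`!%:R != 0 :> R.
Proof. by rewrite pnatr_eq0 -lt0n fact_gt0. Qed.

Lemma beta_moment0 {R : realType} a : beta_moment a 0 = (a.*2.+1%:R)^-1 :> R.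
Proof.
rewrite /beta_moment addn0 fact0 expr0 !mulr1 factS natrM; field.
by rewrite !fact_neq0R addrC natr1 pnatr_eq0.
Qed.

(** Mirrors (1 - z^2)^(j+1) = (1 - z^2)^j - z^2 (1 - z^2)^j. The node averages obey the same
    recursion, which identifies their limits. *)
Lemma beta_momentS {R : realType} a j :
  beta_moment a j.+1 = beta_moment a j - beta_moment a.+1 j :> R.
Proof.
rewrite /beta_moment addnS addSn !doubleS.
rewrite (factS (a + j).*2.+2) (factS (a + j).*2.+1) (factS j) (factS (a + j)).
rewrite (factS a.*2.+1) (factS a.*2) (factS a) !natrM exprS.
have d n : n.*2%:R = 2 * n%:R :> R by rewrite -muln2 natrM mulrC.
rewrite -!natr1 !d natrD.
have a0 : 0 <= (a%:R : R) by []. have j0 : 0 <= (j%:R : R) by [].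
field; rewrite !fact_neq0R /=; apply/and4P; split; apply: lt0r_neq0; lra.
Qed.

Lemma eq_cvg_seq {R : realType} (u v : nat -> R) (l : R) : (forall N, u N = v N) ->
  (v @ \oo --> l)%classic -> (u @ \oo --> l)%classic.
Proof. by move=> /funext ->. Qed.

Definition zavg {R : realType} (N i j : nat) : R :=
  avg N (fun a => (znode N a : R) ^+ i * (1 - znode N a ^+ 2) ^+ j).

Lemma zavgS {R : realType} N i j :
  zavg N i j.+1 = zavg N i j - zavg N i.+2 j :> R.
Proof.
rewrite /zavg -avgB; apply: eq_avg => a.
by rewrite [_ ^+ j.+1]exprS [_ ^+ i.+2]exprS [_ ^+ i.+1]exprS; ring.
Qed.

Lemma cvg_zavg_even {R : realType} a j :
  ((fun N => zavg N a.*2 j) @ \oo --> (beta_moment a j : R))%classic.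
Proof.
elim: j a => [|j IH] a.
  have := @cvg_znode_moment R a.*2.
  rewrite beta_moment0 -[a.*2.+1]addn1 exprD -mul2n exprM sqrrN expr1n expr1n mul1r expr1 opprK.
  have -> : (1 + 1) / (2 * (2 * a + 1)%:R) = ((2 * a + 1)%:R)^-1 :> R.
    by field; rewrite -[2]/(2%:R : R) -natrM natr1 pnatr_eq0.
  apply: eq_cvg_seq => N.
  by rewrite /zavg; apply: eq_avg => i; rewrite expr0 mulr1.
rewrite beta_momentS.
by apply: eq_cvg_seq (cvgB (IH a) (IH a.+1)) => N; rewrite zavgS doubleS.
Qed.

Lemma cvg_zavg_odd {R : realType} i j : odd i ->
  ((fun N => zavg N i j) @ \oo --> (0 : R))%classic.
Proof.
elim: j i => [|j IH] i oi.
  have := @cvg_znode_moment R i.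
  have -> : (-1) ^+ i.+1 = 1 :> R by rewrite exprS -signr_odd oi expr1; ring.
  rewrite subrr mul0r.
  apply: eq_cvg_seq => N.
  by rewrite /zavg; apply: eq_avg => k; rewrite expr0 mulr1.
rewrite -(subrr 0); have oi2 : odd i.+2 by rewrite /= negbK.
by apply: eq_cvg_seq (cvgB (IH i oi) (IH _ oi2)) => N; rewrite zavgS.
Qed.

Lemma cvg_sum_fin {R : realType} (T : finType) (u : T -> nat -> R) (l : T -> R) :
  (forall t, (u t @ \oo --> l t)%classic) ->
  ((fun N => \sum_t u t N) @ \oo --> \sum_t l t)%classic.
Proof.
move=> h; elim: (index_enum T) => [|t s IH].
  by rewrite big_nil; apply: (eq_cvg_seq _ (cst 0)); [move=> N; rewrite big_nil|exact: cvg_cst].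
by rewrite big_cons; apply: eq_cvg_seq (cvgD (h t) IH) => N; rewrite big_cons.
Qed.

Lemma sum_even {R : realType} n (F : nat -> R) : (forall k, odd k -> F k = 0) ->
  \sum_(k < n.*2.+1) F k = \sum_(j < n.+1) F j.*2.
Proof.
move=> F0; elim: n => [|n IH]; first by rewrite !big_ord1.
rewrite doubleS 2!big_ord_recr /= IH [RHS]big_ord_recr /= (F0 n.*2.+1) ?addr0//.
by rewrite /= odd_double.
Qed.

(** Integrates the binomial expansion of (z^2 + (1 - z^2))^n = 1: the factorial identity is obtained
    as the limit of node averages that all equal 1. *)
Lemma sum_beta_moment {R : realType} n :
  \sum_(j < n.+1) 'C(n, j)%:R * beta_moment (n - j) j = 1 :> R.
Proof.
have h : ((fun N => \sum_(j < n.+1) 'C(n, j)%:R * zavg N (n - j).*2 j) @ \oo -->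
    \sum_(j < n.+1) 'C(n, j)%:R * (beta_moment (n - j) j : R))%classic.
  apply: (cvg_sum_fin _ (fun (j : 'I_n.+1) N => 'C(n, j)%:R * zavg N (n - j).*2 j)
    (fun j => 'C(n, j)%:R * (beta_moment (n - j) j : R))) => k.
  by apply: cvgM; [exact: cvg_cst|exact: cvg_zavg_even].
apply: (cvg_unique _ h) => //.
apply: (eq_cvg_seq _ (cst 1)); last exact: cvg_cst.
move=> N; rewrite -[RHS](avg_cst N) /zavg; symmetry.
under [RHS]eq_bigr do rewrite -avgZ.
rewrite -(avg_sum _ _ (fun j a => 'C(n, j)%:R * (znode N a ^+ (n - j).*2 * (1 - znode N a ^+ 2) ^+ j))).
apply: eq_avg => a; rewrite -[LHS](expr1n _ n).
have {1}-> : 1 = znode N a ^+ 2 + (1 - znode N a ^+ 2) :> R by ring.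
rewrite exprDn; apply: eq_bigr => j _.
by rewrite -mul2n exprM mulr_natl.
Qed.

(** Absorbs one of the two beta factors in each squared height moment, so that [sum_beta_moment] can
    evaluate what remains. *)
Lemma sphere_moment_coeff {R : realType} n j : (j <= n)%N ->
  'C(n.*2, j.*2)%:R * cosmom j.*2 * beta_moment (n - j) j
  = 'C(n, j)%:R / n.*2.+1%:R :> R.
Proof.
move=> jn; rewrite cosmom_even /beta_moment subnK//.
have bf m k : (k <= m)%N -> 'C(m, k)%:R = m`!%:R / (k`!%:R * (m - k)`!%:R) :> R.
  move=> km; rewrite -(bin_fact km) !natrM; field.
  by rewrite !fact_neq0R.
rewrite !bf//; last 2 first.
- by rewrite -addnn leq_addr.
- by rewrite leq_double.
rewrite -doubleB -[X in (X - j)`!]addnn addnK factS natrM.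
have := @fact_neq0R R; move=> f0.
by field; rewrite !f0 addrC natr1 pnatr_eq0 /= expf_neq0 ?pnatr_eq0.
Qed.

(** * Equidistribution on the sphere *)

(* By Archimedes' hat-box theorem, equidistributed heights and longitudes are
   equidistributed on the sphere. *)
Definition sphere_pt {R : realType} (N : nat) (t : 'I_N.+1 * 'I_N.+1) : 'rV[R]_3 :=
  \row_(i < 3) [:: Num.sqrt (1 - znode N t.1 ^+ 2) * cos (2 * pi * t.2%:R / N.+1%:R);
                   Num.sqrt (1 - znode N t.1 ^+ 2) * sin (2 * pi * t.2%:R / N.+1%:R);
                   znode N t.1]`_i.

Lemma dot3_sphere_pt {R : realType} N (t u : 'I_N.+1 * 'I_N.+1) :
  dot3 (sphere_pt N t) (sphere_pt N u) = znode N t.1 * znode N u.1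
  + Num.sqrt (1 - znode N t.1 ^+ 2) * Num.sqrt (1 - znode N u.1 ^+ 2)
    * cos (- (2 * pi * t.2%:R / N.+1%:R) + 2 * pi * u.2%:R / N.+1%:R) :> R.
Proof.
by rewrite /dot3 !big_ord_recl big_ord0 !mxE /= [- _ + _]addrC cosB; ring.
Qed.

Lemma znode_sqr_le1 {R : realType} N (a : 'I_N.+1) : 0 <= 1 - (znode N a : R) ^+ 2.
Proof.
have /andP[h1 h2] := @znode_itv R N a (ltnW (ltn_ord a)); nra.
Qed.

Lemma dot3_sphere_pt_itv {R : realType} N (t u : 'I_N.+1 * 'I_N.+1) :
  -1 <= dot3 (sphere_pt N t) (sphere_pt N u : 'rV[R]_3) <= 1.
Proof.
rewrite dot3_sphere_pt.
set c := cos _; have c1 : -1 <= c <= 1 by rewrite cos_geN1 cos_le1.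
have := sqr_sqrtr (@znode_sqr_le1 R N t.1).
have := sqr_sqrtr (@znode_sqr_le1 R N u.1).
have := sqrtr_ge0 (1 - (znode N t.1 : R) ^+ 2).
have := sqrtr_ge0 (1 - (znode N u.1 : R) ^+ 2).
set s := Num.sqrt _; set s' := Num.sqrt _; set z := znode N t.1; set z' := znode N u.1.
move: c1 => /andP[c1 c2] s0 s'0 hs hs'.
have ss : 0 <= s' * s by rewrite mulr_ge0.
have h1 : s' * s * c <= s' * s by rewrite ler_piMr.
have h2 : - (s' * s) <= s' * s * c by rewrite -mulrN1 ler_wpM2l.
have := sqr_ge0 (z - z'); have := sqr_ge0 (z + z'); have := sqr_ge0 (s - s').
by move=> h3 h4 h5; apply/andP; split; nra.
Qed.

Lemma dot3_sphere_pt_diag {R : realType} N (t : 'I_N.+1 * 'I_N.+1) :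
  dot3 (sphere_pt N t) (sphere_pt N t : 'rV[R]_3) = 1.
Proof.
rewrite dot3_sphere_pt addNr cos0 mulr1 -!expr2 sqr_sqrtr ?znode_sqr_le1//; ring.
Qed.

(** A mean over pairs, because the quadratic form pairs every point of one shell with every point of
    another. *)
Definition sphere_avg {R : realType} (N : nat) (f : R -> R) : R :=
  (\sum_(t : 'I_N.+1 * 'I_N.+1) \sum_(u : 'I_N.+1 * 'I_N.+1)
     f (dot3 (sphere_pt N t) (sphere_pt N u))) / N.+1%:R ^+ 4.

Lemma sphere_avgE {R : realType} N (f : R -> R) : sphere_avg N f =
  avg N (fun a => avg N (fun b => avg N (fun c => avg N (fun d =>
    f (znode N a * znode N c
       + Num.sqrt (1 - znode N a ^+ 2) * Num.sqrt (1 - znode N c ^+ 2)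
       * cos (- (2 * pi * b%:R / N.+1%:R) + 2 * pi * d%:R / N.+1%:R)))))).
Proof.
rewrite /sphere_avg.
under eq_bigr do under eq_bigr do rewrite dot3_sphere_pt.
have -> : N.+1%:R ^+ 4 = N.+1%:R * (N.+1%:R * (N.+1%:R * N.+1%:R)) :> R by ring.
rewrite -(pair_bigA _ (fun a b : 'I_N.+1 => \sum_(u : 'I_N.+1 * 'I_N.+1) f (znode N a * znode N u.1
       + Num.sqrt (1 - znode N a ^+ 2) * Num.sqrt (1 - znode N u.1 ^+ 2)
       * cos (- (2 * pi * b%:R / N.+1%:R) + 2 * pi * u.2%:R / N.+1%:R)))) /=.
rewrite !invfM !mulrA /avg; congr (_ * _).
rewrite !mulr_suml; apply: eq_bigr => a _.
rewrite !mulr_suml; apply: eq_bigr => b _.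
rewrite -(pair_bigA _ (fun c d : 'I_N.+1 => f (znode N a * znode N c
       + Num.sqrt (1 - znode N a ^+ 2) * Num.sqrt (1 - znode N c ^+ 2)
       * cos (- (2 * pi * b%:R / N.+1%:R) + 2 * pi * d%:R / N.+1%:R)))) /=.
rewrite -!mulrA ![_ * (N.+1%:R^-1 * _)]mulrA; congr (_ / _).
by rewrite !mulr_suml; apply: eq_bigr.
Qed.

Definition zs_avg {R : realType} (N i k : nat) : R :=
  avg N (fun a => (znode N a : R) ^+ i * Num.sqrt (1 - znode N a ^+ 2) ^+ k).

Lemma zs_avg_even {R : realType} N i j : zs_avg N i j.*2 = zavg N i j :> R.
Proof.
by apply: eq_avg => a; rewrite -mul2n exprM sqr_sqrtr// znode_sqr_le1.
Qed.

(** After binomial expansion the mean over longitudes is exact once [n <= N] and does not depend on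
    the first longitude; the two heights then separate, hence the square. *)
Lemma sphere_avg_monomial {R : realType} N n : (n <= N)%N ->
  sphere_avg N (fun x : R => x ^+ n)
  = \sum_(k < n.+1) 'C(n, k)%:R * cosmom k * zs_avg N (n - k) k ^+ 2.
Proof.
move=> nN; rewrite sphere_avgE.
pose P k a : R := znode N a ^+ (n - k) * Num.sqrt (1 - znode N a ^+ 2) ^+ k.
transitivity (avg N (fun a => avg N (fun b => avg N (fun c =>
    \sum_(k < n.+1) 'C(n, k)%:R * P k a * P k c * cosmom k)))).
  apply: eq_avg => a; apply: eq_avg => b; apply: eq_avg => c.
  pose C k d : R := cos (- (2 * pi * b%:R / N.+1%:R) + 2 * pi * d%:R / N.+1%:R) ^+ k.
  transitivity (avg N (fun d => \sum_(k < n.+1) 'C(n, k)%:R * P k a * P k c * C k d)).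
    apply: eq_avg => d; rewrite exprDn; apply: eq_bigr => k _.
    by rewrite -mulr_natl !exprMn /P /C; ring.
  rewrite (avg_sum _ _ (fun k d => 'C(n, k)%:R * P k a * P k c * C k d)).
  apply: eq_bigr => k _; rewrite avgZ avg_cos_pow//.
  by rewrite (leq_trans (ltn_ord k)).
transitivity (avg N (fun a => avg N (fun c =>
    \sum_(k < n.+1) 'C(n, k)%:R * P k a * P k c * cosmom k))).
  by apply: eq_avg => a; rewrite avg_cst.
transitivity (avg N (fun a => \sum_(k < n.+1) ('C(n, k)%:R * cosmom k * zs_avg N (n - k) k) * P k a)).
  apply: eq_avg => a.
  rewrite (avg_sum _ _ (fun k c => 'C(n, k)%:R * P k a * P k c * cosmom k)).
  apply: eq_bigr => k _.
  rewrite (_ : avg _ _ = avg N (fun c => ('C(n, k)%:R * P k a * cosmom k) * P k c)).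
    by rewrite avgZ /zs_avg -/(P k); ring.
  by apply: eq_avg => c; ring.
rewrite (avg_sum _ _ (fun k a => ('C(n, k)%:R * cosmom k * zs_avg N (n - k) k) * P k a)).
by apply: eq_bigr => k _; rewrite avgZ /zs_avg -/(P k) expr2; ring.
Qed.

(** The limit is the mean of x^n over [-1, 1]: the scalar product of two independent uniform points
    of the sphere is uniform there. *)
Lemma cvg_sphere_avg_monomial {R : realType} n :
  ((fun N => sphere_avg N (fun x : R => x ^+ n)) @ \oo -->
   ((1 - (-1) ^+ n.+1) / (2 * n.+1%:R) : R))%classic.
Proof.
(* Halving [k] is meaningful only for even [k]; for odd [k] the factor [cosmom k] vanishes. *)
pose zl i k : R := if odd i then 0 else beta_moment i./2 k./2.
have h : ((fun N => \sum_(k < n.+1) 'C(n, k)%:R * cosmom k * zs_avg N (n - k) k ^+ 2)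
    @ \oo --> \sum_(k < n.+1) 'C(n, k)%:R * cosmom k * zl (n - k)%N k ^+ 2)%classic.
  apply: (cvg_sum_fin _ (fun (k : 'I_n.+1) N => 'C(n, k)%:R * cosmom k * zs_avg N (n - k) k ^+ 2)
    (fun k => 'C(n, k)%:R * cosmom k * zl (n - k)%N k ^+ 2)) => k.
  have [ok|ek] := boolP (odd k).
    rewrite cosmom_odd// mulr0 mul0r.
    by apply: (eq_cvg_seq _ (cst 0)); [move=> N; rewrite mul0r|exact: cvg_cst].
  apply: cvgM; first exact: cvg_cst.
  have hz : ((fun N => zs_avg N (n - k) k) @ \oo --> zl (n - k)%N k)%classic.
    have ek2 : k./2.*2 = k by rewrite -[RHS]odd_double_half (negbTE ek).
    apply: (eq_cvg_seq _ (fun N => zavg N (n - k) k./2)).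
      by move=> N; rewrite -zs_avg_even ek2.
    rewrite /zl; case: ifP => o; first exact: cvg_zavg_odd.
    have o2 : ((n - k)./2.*2 = n - k)%N by rewrite -[RHS]odd_double_half o.
    by rewrite -[in X in (X @ _)%classic]o2; exact: cvg_zavg_even.
  by apply: eq_cvg_seq (cvgM hz hz) => N; rewrite expr2.
have -> : (1 - (-1) ^+ n.+1) / (2 * n.+1%:R)
   = \sum_(k < n.+1) 'C(n, k)%:R * cosmom k * zl (n - k)%N k ^+ 2.
  rewrite exprS -signr_odd; case: (boolP (odd n)) => on /=.
    rewrite expr1 mulrNN mulr1 subrr mul0r big1// => -[k kn] _ /=.
    have [ok|ek] := boolP (odd k); first by rewrite cosmom_odd// mulr0 mul0r.
    by rewrite /zl oddB// on (negbTE ek) expr0n mulr0.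
  have -> : n = n./2.*2 by rewrite -[LHS]odd_double_half (negbTE on).
  set N := n./2.
  rewrite (sum_even _ (fun k => 'C(N.*2, k)%:R * cosmom k * zl (N.*2 - k)%N k ^+ 2)); last first.
    by move=> k ok; rewrite cosmom_odd// mulr0 mul0r.
  rewrite expr0 mulr1 opprK.
  transitivity (N.*2.+1%:R^-1 * \sum_(j < N.+1) 'C(N, j)%:R * (beta_moment (N - j) j : R)).
    by rewrite sum_beta_moment; field; rewrite addrC natr1 pnatr_eq0.
  rewrite mulr_sumr; apply: eq_bigr => -[j jN] _ /=.
  rewrite /zl -doubleB odd_double !doubleK expr2 mulrA sphere_moment_coeff//; ring.
apply: cvg_trans h; apply: near_eq_cvg; near=> N.
rewrite sphere_avg_monomial//; near: N; exact: nbhs_infty_ge.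
Unshelve. all: by end_near. Qed.

Lemma sphere_avg_sum {R : realType} N n (c : nat -> R) (f : nat -> R -> R) :
  sphere_avg N (fun x => \sum_(i < n) c i * f i x) = \sum_(i < n) c i * sphere_avg N (f i).
Proof.
rewrite /sphere_avg; under eq_bigr do rewrite exchange_big /=.
rewrite exchange_big /= mulr_suml; apply: eq_bigr => i _.
rewrite mulrA; congr (_ * _); rewrite mulr_sumr; apply: eq_bigr => t _.
by rewrite mulr_sumr.
Qed.

Lemma sphere_avg_dist {R : realType} N (f g : R -> R) (e : R) :
  (forall x, -1 <= x <= 1 -> `|f x - g x| <= e) ->
  `|sphere_avg N f - sphere_avg N g| <= e.
Proof.
move=> h; rewrite /sphere_avg -mulrBl normrM.
have N0 : 0 < (N.+1%:R : R) ^+ 4 by rewrite exprn_gt0// ltr0n.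
rewrite [X in _ * X]gtr0_norm ?invr_gt0// ler_pdivrMr//.
rewrite -sumrB; apply: le_trans (ler_norm_sum _ _ _) _.
apply: (@le_trans _ _ (\sum_(t : 'I_N.+1 * 'I_N.+1) \sum_(u : 'I_N.+1 * 'I_N.+1) e)).
  apply: ler_sum => t _; rewrite -sumrB; apply: le_trans (ler_norm_sum _ _ _) _.
  by apply: ler_sum => u _; apply: h; exact: dot3_sphere_pt_itv.
rewrite !sumr_const card_prod card_ord -mulrnA -[e *+ _]mulr_natr !natrM.
by rewrite le_eqVlt; apply/orP; left; apply/eqP; ring.
Qed.

Lemma cvg_sphere_avg_horner {R : realType} (p : {poly R}) :
  ((fun N => sphere_avg N (horner p)) @ \oo -->
    (\sum_(i < size p) p`_i * ((1 - (-1) ^+ i.+1) / (2 * i.+1%:R)) : R))%classic.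
Proof.
apply: (eq_cvg_seq _ (fun N => \sum_(i < size p) p`_i * sphere_avg N (fun x => x ^+ i))).
  move=> N; rewrite -(sphere_avg_sum _ _ (fun i => p`_i) (fun i x => x ^+ i)).
  by congr sphere_avg; apply/funext => x; rewrite horner_coef.
apply: (cvg_sum_fin _ (fun (i : 'I_(size p)) N => p`_i * sphere_avg N (fun x => x ^+ i))
  (fun i => p`_i * ((1 - (-1) ^+ i.+1) / (2 * i.+1%:R)))) => i.
by apply: cvgM; [exact: cvg_cst|exact: cvg_sphere_avg_monomial].
Qed.

Definition primitive {R : realType} (p : {poly R}) (x : R) : R :=
  \sum_(i < size p) (p`_i / i.+1%:R) * x ^+ i.+1.

Lemma is_derive_primitive {R : realType} (p : {poly R}) (x : R) :
  is_derive x 1 (primitive p) p.[x].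
Proof.
pose q : {poly R} := \sum_(i < size p) (p`_i / i.+1%:R) *: 'X ^+ i.+1.
have -> : primitive p = horner q.
  by apply/funext => y; rewrite horner_sum; apply: eq_bigr => i _; rewrite !hornerE.
apply: is_derive_eq; rewrite /q linear_sum horner_sum horner_coef; apply: eq_bigr => i _.
rewrite /= linearZ /= derivXn /= hornerZ hornerMn hornerXn -[_ *+ i.+1]mulr_natr; field.
by rewrite addrC natr1 pnatr_eq0.
Qed.

(** A polynomial within [e / 3] of [f] carries the limit. The mean value theorem for
    [F - primitive p] compares the two limits, so no integral of [f] is formed. *)
Lemma cvg_sphere_avg {R : realType} (f F : R -> R) : continuous f ->
  (forall x : R, -1 <= x <= 1 -> is_derive x 1 F (f x)) ->
  ((fun N => sphere_avg N f) @ \oo --> (F 1 - F (-1)) / 2)%classic.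
Proof.
move=> fc hF; apply/cvgrPdist_le => e e0.
have e3 : 0 < e / 3 by rewrite divr_gt0.
have [p hp] := @weierstrass R f _ fc e3.
have /cvgrPdist_le /(_ _ e3) := @cvg_sphere_avg_horner R p.
have -> : \sum_(i < size p) p`_i * ((1 - (-1) ^+ i.+1) / (2 * i.+1%:R))
   = (primitive p 1 - primitive p (-1)) / 2.
  rewrite /primitive -sumrB mulr_suml; apply: eq_bigr => i _.
  by rewrite expr1n; field; rewrite addrC natr1 pnatr_eq0.
apply: filterS => N hN.
have h1 := @sphere_avg_dist R N f (horner p) _ hp.
have h2 : `|(F 1 - F (-1)) / 2 - (primitive p 1 - primitive p (-1)) / 2| <= e / 3.
  have hd : forall x : R, -1 <= x <= 1 -> is_derive x 1 (F - primitive p) (f x - p.[x]).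
    by move=> x /hF Fx; apply: is_deriveB; exact: is_derive_primitive.
  have [|||c c1] := @MVT R (F - primitive p) (fun x => f x - p.[x]) (-1) 1.
  - by lra.
  - by move=> x; rewrite in_itv /= => /andP[x1 x2]; apply: hd; rewrite !ltW.
  - apply: derivable_within_continuous => x; rewrite in_itv /= => /hd.
    by move=> h; exact: ex_derive.
  rewrite /= => hc; move: c1; rewrite in_itv /= => /andP[c1 c2].
  have := hp c; rewrite (ltW c1) (ltW c2) => /(_ isT).
  have -> : (F 1 - F (-1)) / 2 - (primitive p 1 - primitive p (-1)) / 2 = f c - p.[c].
    by move: hc; rewrite !fctE; lra.
  by [].
have := ler_distD ((primitive p 1 - primitive p (-1)) / 2) ((F 1 - F (-1)) / 2) (sphere_avg N f).
have := ler_distD (sphere_avg N (horner p)) ((primitive p 1 - primitive p (-1)) / 2) (sphere_avg N f).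
rewrite (distrC (sphere_avg N (horner p)) (sphere_avg N f)) => h3 h4.
by lra.
Qed.

(** * Reduction to mass 1, and means over shells *)

Definition unit_energy {R : realType} (x : 'rV[R]_3) : R := Num.sqrt (1 + dot3 x x).

(** The factor 1 / (2 sqrt(e_k e_p)) of a causal kernel is left out, being absorbed by the
    coefficients. *)
Definition energy_pd {R : realType} (phi : R -> R) : Prop :=
  forall (n : nat) (x : 'I_n -> 'rV[R]_3) (c : 'I_n -> R),
    0 <= \sum_(i < n) \sum_(j < n) c i * c j *
      ((unit_energy (x i) + unit_energy (x j)) *
       phi (unit_energy (x i) * unit_energy (x j) - dot3 (x i) (x j))).

Lemma dot3E {R : realType} (x y : 'rV[R]_3) : dot3 x y =
  x ord0 ord0 * y ord0 ord0 + x ord0 (lift ord0 ord0) * y ord0 (lift ord0 ord0)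
  + x ord0 (lift ord0 (lift ord0 ord0)) * y ord0 (lift ord0 (lift ord0 ord0)).
Proof. by rewrite /dot3 !big_ord_recl big_ord0 addr0 addrA. Qed.

Lemma dot3_ge0 {R : realType} (x : 'rV[R]_3) : 0 <= dot3 x x.
Proof. by apply: sumr_ge0 => i _; rewrite -expr2 sqr_ge0. Qed.

Lemma dot3Z {R : realType} (a b : R) (x y : 'rV[R]_3) :
  dot3 (a *: x) (b *: y) = a * b * dot3 x y.
Proof. by rewrite !dot3E !mxE; ring. Qed.

Lemma unit_energy_gt0 {R : realType} (x : 'rV[R]_3) : 0 < unit_energy x.
Proof. by rewrite sqrtr_gt0; have := dot3_ge0 x; lra. Qed.

Lemma unit_mink_ge1 {R : realType} (x y : 'rV[R]_3) :
  1 <= unit_energy x * unit_energy y - dot3 x y.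
Proof.
rewrite lerBrDr /unit_energy -sqrtrM; last by have := dot3_ge0 x; lra.
apply: le_trans (ler_norm _) _; rewrite -sqrtr_sqr; apply: ler_wsqrtr.
rewrite !dot3E.
set a := x _ _; set b := x _ _; set c := x _ _.
set d := y _ _; set e := y _ _; set f := y _ _.
rewrite -subr_ge0.
(* Lagrange's identity *)
have -> : (1 + (a * a + b * b + c * c)) * (1 + (d * d + e * e + f * f))
   - (1 + (a * d + b * e + c * f)) ^+ 2
  = (a - d) ^+ 2 + (b - e) ^+ 2 + (c - f) ^+ 2
    + ((a * e - b * d) ^+ 2 + (a * f - c * d) ^+ 2 + (b * f - c * e) ^+ 2) by ring.
by rewrite !addr_ge0 ?sqr_ge0.
Qed.

Lemma energyZ {R : realType} (m : R) (x : 'rV[R]_3) : 0 < m ->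
  energy m (m *: x) = m * unit_energy x.
Proof.
move=> m0; rewrite /energy dot3Z -[_ ^+ 2]mulr1 expr2 -mulrDr sqrtrM ?mulr_ge0 ?ltW//.
by rewrite -expr2 sqrtr_sqr gtr0_norm.
Qed.

Lemma minkZ {R : realType} (m : R) (x y : 'rV[R]_3) : 0 < m ->
  mink m (m *: x) (m *: y) = m ^+ 2 * (unit_energy x * unit_energy y - dot3 x y).
Proof. by move=> m0; rewrite /mink !energyZ// dot3Z; ring. Qed.

(** Momenta are scaled by [m], and each coefficient is multiplied by the square root of its energy
    to cancel the denominator of [energy_factor]. *)
Lemma causal_kernel_energy_pd {R : realType} (m : R)
    (K : 'rV[R]_3 -> 'rV[R]_3 -> R[i]) (g phi : R -> R) : 0 < m ->
  positive_definite K ->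
  (forall k p, K k p = (energy_factor m k p * g (mink m k p))%:C) ->
  (forall t, 1 <= t -> phi t = g (m ^+ 2 * t)) ->
  energy_pd phi.
Proof.
move=> m0 pdK KE phiE n x c.
pose d i : R := c i * Num.sqrt (unit_energy (x i)).
have := pdK n (fun i => m *: x i) (fun i => (d i)%:C).
under eq_bigr do under eq_bigr do rewrite KE conjc_real -!rmorphM /=.
under eq_bigr do rewrite -rmorph_sum /=.
rewrite -rmorph_sum /= -[0]/(0%:C) lecR => h.
apply: (le_trans (mulr_ge0 (ler0n R 2) h)); rewrite le_eqVlt; apply/orP; left; apply/eqP.
rewrite mulr_sumr; apply: eq_bigr => i _; rewrite mulr_sumr; apply: eq_bigr => j _.
rewrite minkZ// -phiE ?unit_mink_ge1// /energy_factor !energyZ// /d.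
set ei := unit_energy _; set ej := unit_energy _.
have ei0 : 0 < ei := unit_energy_gt0 _; have ej0 : 0 < ej := unit_energy_gt0 _.
have -> : Num.sqrt (m * ei * (m * ej)) = m * (Num.sqrt ei * Num.sqrt ej).
  have -> : m * ei * (m * ej) = m ^+ 2 * (ei * ej) by ring.
  by rewrite sqrtrM ?sqr_ge0// sqrtr_sqr gtr0_norm// sqrtrM// ltW.
have : Num.sqrt ei != 0 by rewrite gt_eqF// sqrtr_gt0.
have : Num.sqrt ej != 0 by rewrite gt_eqF// sqrtr_gt0.
move=> s0 s1; field; rewrite s0 s1 gt_eqF//.
Qed.

Lemma energy_pd_fin {R : realType} (phi : R -> R) (T : finType)
    (x : T -> 'rV[R]_3) (c : T -> R) : energy_pd phi ->
  0 <= \sum_t \sum_u c t * c u *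
      ((unit_energy (x t) + unit_energy (x u)) *
       phi (unit_energy (x t) * unit_energy (x u) - dot3 (x t) (x u))).
Proof.
move=> h.
have re (F : T -> R) : \sum_t F t = \sum_(i < #|T|) F (enum_val i).
  by rewrite (reindex (@enum_val T T))//; apply: onW_bij; exact: enum_val_bij.
rewrite re; under eq_bigr do rewrite re.
exact: (h _ (fun i => x (enum_val i)) (fun i => c (enum_val i))).
Qed.

(* Spreading each coefficient uniformly over a sphere replaces the kernel by its angular mean. *)
Lemma energy_pd_shells {R : realType} (phi : R -> R) (n : nat) (r e a : 'I_n -> R)
    (J : 'I_n -> 'I_n -> R) : energy_pd phi ->
  (forall i, e i = Num.sqrt (1 + r i ^+ 2)) ->
  (forall i j, ((fun N => sphere_avg N (fun z => phi (e i * e j - r i * r j * z)))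
      @ \oo --> J i j)%classic) ->
  0 <= \sum_(i < n) \sum_(j < n) a i * a j * ((e i + e j) * J i j).
Proof.
move=> h eE hJ.
have hc : ((fun N => \sum_(i < n) \sum_(j < n) a i * a j * ((e i + e j) *
    sphere_avg N (fun z => phi (e i * e j - r i * r j * z)))) @ \oo -->
  \sum_(i < n) \sum_(j < n) a i * a j * ((e i + e j) * J i j))%classic.
  apply: (cvg_sum_fin _ (fun i N => \sum_(j < n) a i * a j * ((e i + e j) *
    sphere_avg N (fun z => phi (e i * e j - r i * r j * z))))) => i.
  apply: (cvg_sum_fin _ (fun j N => a i * a j * ((e i + e j) *
    sphere_avg N (fun z => phi (e i * e j - r i * r j * z))))) => j.
  by apply: cvgM; [exact: cvg_cst|apply: cvgM; [exact: cvg_cst|exact: hJ]].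
(* For fixed [N], multiplication by (N + 1)^4 turns the sum into the quadratic form on all points of
   all shells. *)
apply: (cvgr_to_ge hc); apply: nearW => N.
pose T : finType := ('I_N.+1 * 'I_N.+1)%type.
have ue i (t : T) : unit_energy (r i *: sphere_pt N t) = e i.
  by rewrite /unit_energy dot3Z dot3_sphere_pt_diag mulr1 -expr2 eE.
have := @energy_pd_fin R phi ('I_n * T)%type (fun s => r s.1 *: sphere_pt N s.2)
  (fun s => a s.1) h.
have N0 : 0 < (N.+1%:R ^+ 4 : R) by rewrite exprn_gt0// ltr0n.
move=> hp; rewrite -(pmulr_rge0 _ N0); move: hp; congr (0 <= _).
rewrite -(pair_bigA _ (fun i (t : T) => \sum_(u : 'I_n * T) a i * a u.1 *
   ((unit_energy (r i *: sphere_pt N t) + unit_energy (r u.1 *: sphere_pt N u.2)) *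
    phi (unit_energy (r i *: sphere_pt N t) * unit_energy (r u.1 *: sphere_pt N u.2)
         - dot3 (r i *: sphere_pt N t) (r u.1 *: sphere_pt N u.2))))) /=.
rewrite [RHS]mulr_sumr; apply: eq_bigr => i _.
under eq_bigr => t _.
  rewrite -(pair_bigA _ (fun j (u : T) => a i * a j *
   ((unit_energy (r i *: sphere_pt N t) + unit_energy (r j *: sphere_pt N u)) *
    phi (unit_energy (r i *: sphere_pt N t) * unit_energy (r j *: sphere_pt N u)
         - dot3 (r i *: sphere_pt N t) (r j *: sphere_pt N u))))) /=.
  over.
rewrite exchange_big /= [RHS]mulr_sumr; apply: eq_bigr => j _.
under eq_bigr do under eq_bigr do rewrite !ue dot3Z.
under eq_bigr do rewrite -!mulr_sumr.
rewrite -!mulr_sumr /sphere_avg; set S := \sum_t _.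
by field; rewrite addrC natr1 pnatr_eq0.
Qed.

(** * The kernel of shells in terms of the antiderivative *)

(** Integrating from 0 makes 1 an interior point, so [G] has a two-sided derivative there; a
    constant is then subtracted. *)
Lemma exists_antiderivative {R : realType} (phi : R -> R) : continuous phi ->
  exists G : R -> R, G 1 = 0 /\ forall x : R, 0 < x -> is_derive x 1 G (phi x).
Proof.
move=> pc; pose G0 (x : R) : R := (\int[lebesgue_measure]_(t in [set` `[0%R, x]]) phi t)%R.
have dG (x : R) : 0 < x -> is_derive x 1 G0 (phi x).
  move=> x0.
  have int : lebesgue_measure.-integrable `[0%R, x + 1]%classic (EFin \o phi).
    apply: continuous_compact_integrable; first exact: segment_compact.
    exact: continuous_subspaceT.
  have xx : x < x + 1 by rewrite ltrDl.
  have [] := @continuous_FTC1_closed R phi 0 x (x + 1) xx int x0 (pc x).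
  move=> d e; apply: DeriveDef; first exact: d.
  by rewrite -derive1E; exact: e.
exists (G0 - cst (G0 1)); split; first by rewrite !fctE subrr.
by move=> x /dG ?; apply: is_derive_eq; rewrite subr0.
Qed.

(** The condition [B < A] keeps the argument positive on [-1, 1], where [G] is known to be
    differentiable. *)
Lemma cvg_sphere_avg_affine {R : realType} (phi G : R -> R) (A B : R) :
  continuous phi -> (forall x : R, 0 < x -> is_derive x 1 G (phi x)) -> 0 < B -> B < A ->
  ((fun N => sphere_avg N (fun z => phi (A - B * z))) @ \oo -->
     ((G (A + B) - G (A - B)) / (2 * B) : R))%classic.
Proof.
move=> pc dG B0 BA.
pose F (z : R) : R := - B^-1 * G (A - B * z).
have -> : (G (A + B) - G (A - B)) / (2 * B) = (F 1 - F (-1)) / 2.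
  by rewrite /F mulr1 mulrN1 opprK; field; rewrite gt_eqF.
apply: cvg_sphere_avg.
  move=> z; apply: (@continuous_comp _ _ _ (fun z : R => A - B * z) phi); last exact: pc.
  by apply: cvgB; [exact: cvg_cst|apply: cvgM; [exact: cvg_cst|exact: cvg_id]].
move=> x /andP[x1 x2].
have hx : 0 < A - B * x by nra.
have d1 : is_derive x 1 (fun z : R => A - B * z) (- B).
  rewrite (_ : (fun z : R => _) = cst A - B *: id); last by apply/funext => z; rewrite !fctE.
  by apply: is_derive_eq; rewrite sub0r /GRing.scale /= mulr1.
have := @is_derive1_comp R G (fun z : R => A - B * z) x _ _ (dG _ hx) d1.
move=> d2.
rewrite (_ : F = (- B^-1) *: (G \o (fun z : R => A - B * z))); last by apply/funext.
by apply: is_derive_eq; rewrite /GRing.scale /=; field; rewrite gt_eqF.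
Qed.

(** With w = e^s this is H(s) = G(cosh s); sums and differences of s become products and quotients
    of w. *)
Definition hfun {R : realType} (G : R -> R) (w : R) : R := G ((w + w^-1) / 2).

Lemma hfunV {R : realType} (G : R -> R) (w : R) : hfun G w^-1 = hfun G w.
Proof. by rewrite /hfun invrK addrC. Qed.

Lemma hfun1 {R : realType} (G : R -> R) : hfun G 1 = G 1.
Proof. by rewrite /hfun invr1; congr G; field. Qed.

(* Shells of radius sinh s and energy cosh s are indexed by w = e^s. *)
Lemma hfun_kernel {R : realType} (phi G : R -> R) (n : nat) (w b : 'I_n -> R) :
  continuous phi -> (forall x : R, 0 < x -> is_derive x 1 G (phi x)) -> energy_pd phi ->
  (forall i, 1 < w i) ->
  0 <= \sum_(i < n) \sum_(j < n) b i * b j *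
    ((w i + (w i)^-1 + w j + (w j)^-1) * (hfun G (w i * w j) - hfun G (w i / w j))).
Proof.
move=> pc dG pd w1.
pose r i : R := (w i - (w i)^-1) / 2.
pose e i : R := (w i + (w i)^-1) / 2.
have w0 i : 0 < w i by apply: lt_trans (w1 i).
have wn i : w i != 0 by rewrite gt_eqF.
have wV1 i : (w i)^-1 < 1 by rewrite invf_lt1.
have r0 i : 0 < r i by rewrite divr_gt0// subr_gt0 (lt_trans (wV1 i)).
have rn i : r i != 0 by rewrite gt_eqF.
have eE i : e i = Num.sqrt (1 + r i ^+ 2).
  have -> : 1 + r i ^+ 2 = e i ^+ 2 by rewrite /r /e; field.
  by rewrite sqrtr_sqr gtr0_norm// divr_gt0// addr_gt0// invr_gt0.
pose J i j := (G (e i * e j + r i * r j) - G (e i * e j - r i * r j)) / (2 * (r i * r j)).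
(* The coefficients [b i * r i] cancel the denominator of [J]. *)
have := @energy_pd_shells R phi n r e (fun i => b i * r i) J pd eE.
have eep i j : e i * e j + r i * r j = (w i * w j + (w i * w j)^-1) / 2.
  by rewrite /e /r; field; rewrite !wn.
have eem i j : e i * e j - r i * r j = (w i / w j + (w i / w j)^-1) / 2.
  by rewrite /e /r; field; rewrite !wn.
have hJ i j : ((fun N => sphere_avg N (fun z => phi (e i * e j - r i * r j * z)))
      @ \oo --> J i j)%classic.
  apply: cvg_sphere_avg_affine => //; first by rewrite mulr_gt0.
  by rewrite -subr_gt0 eem divr_gt0// addr_gt0// ?invr_gt0 divr_gt0.
move=> /(_ hJ) => h.
apply: (le_trans (mulr_ge0 (ler0n R 4) h)); rewrite le_eqVlt; apply/orP; left; apply/eqP.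
rewrite mulr_sumr; apply: eq_bigr => i _; rewrite mulr_sumr; apply: eq_bigr => j _.
rewrite /J eep eem -/(hfun G _) -/(hfun G _).
have -> : w i + (w i)^-1 + w j + (w j)^-1 = 2 * (e i + e j) by rewrite /e; field; rewrite !wn.
by field; rewrite !rn.
Qed.

(** * A priori growth of H *)

Lemma form2_det {R : realType} (A B C : R) :
  (forall a b : R, 0 <= A * a ^+ 2 + 2 * B * a * b + C * b ^+ 2) -> 0 < A -> B ^+ 2 <= A * C.
Proof.
move=> h A0; have := h (- B) A.
have -> : A * (- B) ^+ 2 + 2 * B * - B * A + C * A ^+ 2 = A * (A * C - B ^+ 2) by ring.
by rewrite pmulr_rge0// subr_ge0.
Qed.

(** Cauchy-Schwarz between the origin and one point of energy s^2 gives (1 + s^2) phi(s^2) <= 2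
    s. *)
Lemma energy_pd_bound {R : realType} (phi : R -> R) (s : R) : energy_pd phi ->
  phi 1 = 1 -> 1 <= s -> s * phi (s ^+ 2) <= 2.
Proof.
move=> pd phi1 s1.
pose r : R := Num.sqrt ((s ^+ 2) ^+ 2 - 1).
have s2 : 1 <= s ^+ 2 by rewrite exprn_ege1.
have r2 : r ^+ 2 = (s ^+ 2) ^+ 2 - 1 by rewrite sqr_sqrtr// subr_ge0 exprn_ege1.
pose x (i : 'I_2) : 'rV[R]_3 := (if i == ord0 then 0 else r) *: sphere_pt 0 (ord0, ord0).
have x0 : unit_energy (x ord0) = 1.
  by rewrite /unit_energy dot3Z /= !mul0r addr0 sqrtr1.
have x1 : unit_energy (x (lift ord0 ord0)) = s ^+ 2.
  rewrite /unit_energy dot3Z /= dot3_sphere_pt_diag mulr1 -expr2 r2 addrC subrK.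
  by rewrite sqrtr_sqr ger0_norm// (le_trans ler01).
have d01 : dot3 (x ord0) (x (lift ord0 ord0)) = 0 by rewrite dot3Z /= !mul0r.
have d10 : dot3 (x (lift ord0 ord0)) (x ord0) = 0 by rewrite dot3Z /= mulr0 mul0r.
have d00 : dot3 (x ord0) (x ord0) = 0 by rewrite dot3Z /= !mul0r.
have d11 : dot3 (x (lift ord0 ord0)) (x (lift ord0 ord0)) = (s ^+ 2) ^+ 2 - 1.
  by rewrite dot3Z /= dot3_sphere_pt_diag mulr1 -expr2.
have h : ((1 + s ^+ 2) * phi (s ^+ 2)) ^+ 2 <= 2 * (2 * s ^+ 2).
  apply: form2_det => // a b.
  have := pd 2 x (fun i => if i == ord0 then a else b).
  rewrite !big_ord_recl !big_ord0 /= x0 x1 d01 d10 d00 d11.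
  have -> : s ^+ 2 * s ^+ 2 - (s ^+ 2 ^+ 2 - 1) = 1 by ring.
  rewrite !subr0 mulr1 mul1r mulr1 phi1 => hh.
  by apply: le_trans hh _; rewrite le_eqVlt; apply/orP; left; apply/eqP; ring.
have [p0|p0] := leP (phi (s ^+ 2)) 0; first by nra.
have hp : 0 <= s * phi (s ^+ 2) by apply: mulr_ge0; lra.
rewrite -(@ler_pXn2r _ 2) ?nnegrE//.
have h2 : (s ^+ 2 * (s * phi (s ^+ 2))) ^+ 2 <= ((1 + s ^+ 2) * (s * phi (s ^+ 2))) ^+ 2.
  have u0 : 0 <= s ^+ 2 * (s * phi (s ^+ 2)) by apply: mulr_ge0 => //; lra.
  have uv : s ^+ 2 * (s * phi (s ^+ 2)) <= (1 + s ^+ 2) * (s * phi (s ^+ 2)).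
    by apply: ler_wpM2r => //; lra.
  by rewrite ler_pXn2r ?nnegrE//; exact: le_trans uv.
have s40 : 0 < s ^+ 2 ^+ 2 by rewrite exprn_gt0// exprn_gt0//; lra.
rewrite -(ler_pM2l s40) -exprMn; apply: le_trans h2 _.
have -> : ((1 + s ^+ 2) * (s * phi (s ^+ 2))) ^+ 2 = s ^+ 2 * ((1 + s ^+ 2) * phi (s ^+ 2)) ^+ 2 by ring.
have s20 : 0 <= s ^+ 2 by rewrite sqr_ge0.
by apply: le_trans (ler_wpM2l s20 h) _; rewrite le_eqVlt; apply/orP; left; apply/eqP; ring.
Qed.

(** The derivative of G(s^2) is 2 s phi(s^2) <= 4, and the mean value theorem applies on [1, s]. *)
Lemma antiderivative_growth {R : realType} (phi G : R -> R) (s : R) : energy_pd phi ->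
  (forall x : R, 0 < x -> is_derive x 1 G (phi x)) -> phi 1 = 1 -> G 1 = 0 -> 1 <= s ->
  G (s ^+ 2) <= 4 * s.
Proof.
move=> pd dG phi1 G1 s1.
have [->|sn1] := eqVneq s 1; first by rewrite expr1n G1 mulr1.
have s1' : 1 < s by rewrite lt_neqAle eq_sym sn1.
have dc (x : R) : 0 < x -> is_derive x 1 (G \o (fun y => y ^+ 2)) (phi (x ^+ 2) * (2 * x)).
  move=> x0; have x20 : 0 < x ^+ 2 by rewrite exprn_gt0.
  have d1 : is_derive x 1 (fun y : R => y ^+ 2) (2 * x).
    rewrite (_ : (fun y : R => _) = id ^+ 2); last by apply/funext.
    by apply: is_derive_eq; rewrite /GRing.scale /= mulr1 expr1 -mulr_natl.
  exact: (@is_derive1_comp R G (fun y : R => y ^+ 2) x _ _ (dG _ x20) d1).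
have [||c] := @MVT R (G \o (fun y => y ^+ 2)) (fun x => phi (x ^+ 2) * (2 * x)) 1 s s1'.
- by move=> x; rewrite in_itv /= => /andP[x1 _]; apply: dc; lra.
- apply: derivable_within_continuous => x; rewrite in_itv /= => /andP[x1 _].
  have /dc h : 0 < x by lra.
  exact: ex_derive.
rewrite in_itv /= => /andP[c1 c2]; rewrite expr1n G1 subr0 => ->.
have := @energy_pd_bound R phi c pd phi1 (ltW c1); nra.
Qed.

Lemma hfun_growth {R : realType} (phi G : R -> R) (q : R) : energy_pd phi ->
  (forall x : R, 0 < x -> is_derive x 1 G (phi x)) -> phi 1 = 1 -> G 1 = 0 -> 1 <= q ->
  hfun G (q ^+ 2) <= 4 * q.
Proof.
move=> pd dG phi1 G1 q1.
have q0 : 0 < q by lra.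
have qV : (q ^+ 2)^-1 <= q ^+ 2.
  by apply: (@le_trans _ _ 1); rewrite ?invf_le1 ?exprn_gt0// exprn_ege1//; lra.
have q21 : 1 <= (q ^+ 2 + (q ^+ 2)^-1) / 2.
  have x0 : 0 < q ^+ 2 by rewrite exprn_gt0.
  rewrite -subr_ge0.
  have -> : (q ^+ 2 + (q ^+ 2)^-1) / 2 - 1 = (q ^+ 2 - 1) ^+ 2 / (2 * q ^+ 2).
    by field; rewrite gt_eqF.
  by rewrite divr_ge0 ?sqr_ge0// mulr_ge0// ltW.
set t := (q ^+ 2 + _) / 2 in q21.
have t0 : 0 <= t by lra.
rewrite /hfun -/t -(sqr_sqrtr t0).
have st1 : 1 <= Num.sqrt t by rewrite -sqrtr1 ler_wsqrtr.
apply: le_trans (antiderivative_growth _ _ _ pd dG phi1 G1 st1) _.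
have qE : Num.sqrt (q ^+ 2) = q by rewrite sqrtr_sqr gtr0_norm.
by rewrite ler_pM2l// -[leRHS]qE ler_wsqrtr// /t; lra.
Qed.

(** The case of a single shell, of index sqrt(w): the subtracted term is [hfun G 1] = 0. *)
Lemma hfun_ge0 {R : realType} (phi G : R -> R) (w : R) : continuous phi ->
  (forall x : R, 0 < x -> is_derive x 1 G (phi x)) -> energy_pd phi -> G 1 = 0 ->
  1 <= w -> 0 <= hfun G w.
Proof.
move=> pc dG pd G1 w1.
have [->|wn1] := eqVneq w 1; first by rewrite hfun1 G1.
have w1' : 1 < w by rewrite lt_neqAle eq_sym wn1.
have s1 : 1 < Num.sqrt w by rewrite -[ltLHS]sqrtr1 ltr_sqrt//; lra.
have := @hfun_kernel R phi G 1 (fun=> Num.sqrt w) (fun=> 1) pc dG pd (fun=> s1).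
rewrite !big_ord1 !mul1r divff ?gt_eqF//; last by lra.
rewrite hfun1 G1 subr0 -expr2 sqr_sqrtr; last by lra.
have sV : 0 < (Num.sqrt w)^-1 by rewrite invr_gt0; lra.
by rewrite pmulr_rge0//; lra.
Qed.

(** * The doubling inequality *)

(** While positive, the sequence drops by at least [c] at each step; once nonpositive, it is at most
    [- c] from the next step on. The value t = 1 is included for the root 1. *)
Lemma eventually_le_opp {R : realType} (x : nat -> R) (t c : R) J :
  0 <= t <= 1 -> 0 < c -> (forall j, (J <= j)%N -> x j.+1 <= t * x j - c) ->
  exists J', forall j, (J' <= j)%N -> x j <= - c.
Proof.
move=> /andP[t0 t1] c0 h.
have stay j : (J <= j)%N -> x j <= 0 -> forall n, x (j + n).+1 <= - c.
  move=> Jj xj; elim=> [|n IH].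
    by rewrite addn0; apply: le_trans (h _ Jj) _; nra.
  have /h : (J <= (j + n).+1)%N by rewrite (leq_trans Jj)// leqW// leq_addr.
  by rewrite addnS => /le_trans; apply; nra.
have [[j [Jj xj]]|hn] := pselect (exists j, (J <= j)%N /\ x j <= 0).
  exists j.+1 => k jk; have := stay j Jj xj (k - j.+1)%N.
  by rewrite -addSn subnKC.
exfalso; have pos j : (J <= j)%N -> 0 < x j.
  by move=> Jj; rewrite ltNge; apply/negP => xj; apply: hn; exists j.
have dec n : x (J + n)%N <= x J - c * n%:R.
  elim: n => [|n IH]; first by rewrite addn0 mulr0 subr0.
  have Jn : (J <= J + n)%N by rewrite leq_addr.
  have := h _ Jn; have := pos _ Jn; rewrite addnS -natr1; nra.
pose n := (Num.truncn (x J / c)).+1.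
have := truncnS_gt (x J / c); rewrite ltr_pdivrMr// -/n => hn'.
have := dec n; have := pos (J + n)%N (leq_addr _ _); rewrite (mulrC c); lra.
Qed.

Lemma expn_unbounded {R : realType} (x C : R) : 1 < x -> exists n, C < x ^+ n.
Proof.
move=> x1.
have hb n : 1 + n%:R * (x - 1) <= x ^+ n.
  elim: n => [|n IH]; first by rewrite mul0r addr0 expr0.
  rewrite exprS -natr1.
  have n0 : 0 <= (n%:R : R) by [].
  have : x * (1 + n%:R * (x - 1)) <= x * x ^+ n by rewrite ler_wpM2l//; lra.
  by have := mulr_ge0 n0 (sqr_ge0 (x - 1)); rewrite expr2; nra.
exists (Num.truncn (C / (x - 1))).+1.
have := truncnS_gt (C / (x - 1)); rewrite ltr_pdivrMr ?subr_gt0//.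
by have := hb (Num.truncn (C / (x - 1))).+1; lra.
Qed.

(* The symbol factors as (X - 1)(X - rho)(q^2 X - 1)(q^2 X - rho), whose only root
   outside the unit disc is rho, which the growth bound rules out; the root 1
   then forces a linear descent. *)
Lemma recurrence_contradiction {R : realType} (b : nat -> R) (q rho C k : R) (J : nat) :
  1 < q -> q < rho -> rho < q ^+ 2 -> 0 < k ->
  (forall j, 0 <= b j) -> (forall j, b j <= C * q ^+ j) ->
  (forall j, (J <= j)%N -> k <=
     rho ^+ 2 * b j - rho * (1 + rho) * (1 + q ^+ 2) * b j.+1
     + ((1 + rho) ^+ 2 * q ^+ 2 + rho * (1 + q ^+ 2 ^+ 2)) * b j.+2
     - (1 + rho) * (q ^+ 2 + q ^+ 2 ^+ 2) * b j.+3 + q ^+ 2 ^+ 2 * b j.+4) -> False.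
Proof.
move=> q1; set Q := q ^+ 2 => qr rQ k0 b0 bC hM.
have C0 : 0 <= C by have := bC 0%N; have := b0 0%N; rewrite expr0 mulr1; lra.
(* With X the shift, these apply Q X - 1, then Q X - rho, then X - 1; the last factor X - rho is
   left to the hypothesis. *)
pose g j := Q * b j.+1 - b j.
pose be j := Q * g j.+1 - rho * g j.
pose de j := be j.+1 - be j.
have hde j : (J <= j)%N -> k <= de j.+1 - rho * de j.
  move=> /hM /le_trans; apply; rewrite le_eqVlt; apply/orP; left; apply/eqP.
  by rewrite /de /be /g; ring.
have qj0 j : 0 < q ^+ j by rewrite exprn_gt0//; lra.
have [C2 C20 hC2] : exists2 C2, 0 < C2 & forall j, de j <= C2 * q ^+ j.
  have [q0 Q0 r0] : [/\ 0 <= q, 0 <= Q & 0 <= rho] by split; lra.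
  have T0 : 0 <= Q + rho + rho * Q by rewrite !addr_ge0// mulr_ge0.
  have S0 : 0 <= Q ^+ 2 * q ^+ 3 + (Q + rho + rho * Q) * q.
    by apply: addr_ge0; apply: mulr_ge0 => //; exact: exprn_ge0.
  exists (1 + C * (Q ^+ 2 * q ^+ 3 + (Q + rho + rho * Q) * q)).
    by rewrite ltr_pwDl// mulr_ge0.
  move=> j.
  have -> : de j = Q ^+ 2 * b j.+3 - (Q + rho * Q + Q ^+ 2) * b j.+2
     + (Q + rho + rho * Q) * b j.+1 - rho * b j.
    by rewrite /de /be /g; ring.
  have h3 : Q ^+ 2 * b j.+3 <= Q ^+ 2 * (C * q ^+ j.+3) by rewrite ler_wpM2l// exprn_ge0.
  have h2 : 0 <= (Q + rho * Q + Q ^+ 2) * b j.+2.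
    by apply: mulr_ge0 => //; rewrite !addr_ge0// ?exprn_ge0// mulr_ge0.
  have h1 : (Q + rho + rho * Q) * b j.+1 <= (Q + rho + rho * Q) * (C * q ^+ j.+1).
    by rewrite ler_wpM2l.
  have h0 : 0 <= rho * b j by rewrite mulr_ge0.
  apply: (@le_trans _ _ (Q ^+ 2 * (C * q ^+ j.+3) + (Q + rho + rho * Q) * (C * q ^+ j.+1))).
    by lra.
  rewrite -subr_ge0 (exprS q j.+2) (exprS q j.+1) (exprS q j).
  set P := q ^+ j; have P0 : 0 < P := qj0 j.
  have -> : (1 + C * (Q ^+ 2 * q ^+ 3 + (Q + rho + rho * Q) * q)) * P -
    (Q ^+ 2 * (C * (q * (q * (q * P)))) + (Q + rho + rho * Q) * (C * (q * P))) = P by ring.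
  exact: ltW.
have r1 : 1 < rho by lra.
(* A positive value would grow at least like rho^n, against the bound of order q^n with q < rho. *)
have de_le0 j : (J <= j)%N -> de j <= 0.
  move=> Jj; rewrite leNgt; apply/negP => dj.
  have gr n : rho ^+ n * de j <= de (j + n)%N.
    elim: n => [|n IH]; first by rewrite expr0 mul1r addn0.
    rewrite exprS -mulrA addnS.
    have Jn : (J <= j + n)%N by rewrite (leq_trans Jj)// leq_addr.
    have := hde _ Jn.
    have : rho * (rho ^+ n * de j) <= rho * de (j + n)%N by rewrite ler_wpM2l//; lra.
    lra.
  have rq1 : 1 < rho / q by rewrite ltr_pdivlMr ?mul1r//; lra.
  have [n] := expn_unbounded (rho / q) (C2 * q ^+ j / de j) rq1.
  rewrite ltr_pdivrMr// expr_div_n mulrAC ltr_pdivlMr// -mulrA -exprD.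
  have := gr n; have := hC2 (j + n)%N; lra.
have [J1 hJ1] : exists J1, forall j, (J1 <= j)%N -> be j <= - (k / rho).
  apply: (eventually_le_opp be 1 (k / rho) J); first by rewrite ler01 lexx.
    by rewrite divr_gt0//; lra.
  move=> j Jj; rewrite mul1r.
  have h1 := de_le0 _ (leqW Jj); have h2 := hde _ Jj.
  have : de j <= - (k / rho).
    have -> : - (k / rho) = - k / rho by rewrite mulNr.
    rewrite ler_pdivlMr; [|lra]; lra.
  rewrite /de; lra.
have Q1 : 1 < Q by lra.
have [J2 hJ2] : exists J2, forall j, (J2 <= j)%N -> g j <= - (k / rho / Q).
  apply: (eventually_le_opp g (rho / Q) (k / rho / Q) J1).
  - by rewrite divr_ge0 ?ler_pdivrMr ?mul1r ?ltW//=; lra.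
  - by rewrite !divr_gt0//; lra.
  move=> j /hJ1; rewrite /be => h.
  have -> : rho / Q * g j - k / rho / Q = (rho * g j - k / rho) / Q by ring.
  rewrite ler_pdivlMr; [|lra]; rewrite mulrC; lra.
have [J3 hJ3] : exists J3, forall j, (J3 <= j)%N -> b j <= - (k / rho / Q / Q).
  apply: (eventually_le_opp b Q^-1 (k / rho / Q / Q) J2).
  - by rewrite invr_ge0 invf_le1 ?ltW//=; lra.
  - by rewrite !divr_gt0//; lra.
  move=> j /hJ2; rewrite /g => h.
  have -> : Q^-1 * b j - k / rho / Q / Q = (b j - k / rho / Q) / Q by ring.
  rewrite ler_pdivlMr; [|lra]; rewrite mulrC; lra.
have := hJ3 J3 (leqnn _); have := b0 J3.
have : 0 < k / rho / Q / Q by rewrite !divr_gt0//; lra.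
lra.
Qed.

(* Conditional positivity on three shells with indices in geometric progression, far out:
   rho > q keeps the growth rate q of [hfun G (q ^+ 2j)] below the unstable root. *)
Lemma hfun_doubling_aux {R : realType} (phi G : R -> R) (q rho : R) :
  continuous phi -> (forall x : R, 0 < x -> is_derive x 1 G (phi x)) -> energy_pd phi ->
  phi 1 = 1 -> G 1 = 0 -> 1 < q -> q < rho -> rho < q ^+ 2 ->
  rho * (1 + q ^+ 2 ^+ 2) * hfun G (q ^+ 2 ^+ 2)
  <= (1 + rho) * (1 + q ^+ 2) * (rho + q ^+ 2) * hfun G (q ^+ 2).
Proof.
move=> pc dG pd phi1 G1 q1 qr rQ.
pose b j := hfun G ((q ^+ j) ^+ 2).
have b1E : hfun G (q ^+ 2) = b 1%N by rewrite /b expr1.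
have b2E : hfun G (q ^+ 2 ^+ 2) = b 2%N by [].
rewrite b1E b2E leNgt; apply/negP; rewrite -subr_gt0; set D := _ - _ => D0.
have b0 j : 0 <= b j.
  by apply: (hfun_ge0 phi) => //; rewrite !exprn_ege1//; exact: ltW.
have bC j : b j <= 4 * q ^+ j.
  by apply: (hfun_growth phi) => //; rewrite exprn_ege1//; exact: ltW.
(* [4 * P * K] will bound the part [M' - D'] carried by P^-1, since [b j] is at most 4 q^j = 4 P; P
   > 8 K / D then costs at most half of [D]. *)
pose K := rho ^+ 2 + ((1 + rho) ^+ 2 + 2 * rho) * q ^+ 2 + q ^+ 4 + 2 * (1 + rho) ^+ 2 * q.
have [J hJ] := expn_unbounded q (8 * K / D) q1.
apply: (recurrence_contradiction b q rho 4 (D / 2) J.+1 q1 qr rQ _ b0 bC); first by rewrite divr_gt0.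
move=> j jJ; set Q := q ^+ 2; pose P := q ^+ j.
have P1 : 1 < P by rewrite exprn_egt1// -lt0n (leq_trans _ jJ).
have P0 : 0 < P by lra.
have Q1 : 1 < Q by rewrite /Q; lra.
have [Pn Qn] : P != 0 /\ Q != 0 by split; apply: lt0r_neq0; lra.
have PK : 8 * K / D < P.
  by apply: lt_le_trans hJ _; apply: ler_weXn2l; [exact: ltW|exact: ltnW].
pose w (i : 'I_3) : R := P * Q ^+ i.
have w1 i : 1 < w i.
  by apply: (lt_le_trans P1); rewrite ler_peMr ?exprn_ege1//; lra.
pose c (i : 'I_3) : R := [:: rho; - (1 + rho); 1]`_i.
have := @hfun_kernel R phi G 3 w c pc dG pd w1.
have hm i k : hfun G (P * Q ^+ i * (P * Q ^+ k)) = b (j + (i + k))%N.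
  have qe n : Q ^+ n = (q ^+ n) ^+ 2 by rewrite /Q -!exprM mulnC.
  by rewrite /b /P !qe; congr hfun; rewrite !exprD; ring.
have hd i : hfun G (P * Q ^+ i / (P * Q ^+ i)) = 0.
  by rewrite divff ?hfun1// mulf_neq0// expf_neq0.
have hd1 i k : hfun G (P * Q ^+ (i + k) / (P * Q ^+ i)) = b k.
  rewrite /b -exprM mulnC exprM; congr hfun; rewrite exprD -/Q.
  by field; rewrite Pn expf_neq0.
have hd2 i k : hfun G (P * Q ^+ i / (P * Q ^+ (i + k))) = b k.
  by rewrite -hfunV invf_div hd1.
rewrite !big_ord_recl !big_ord0 /w /c /= !hm !addr0.
rewrite !hd (hd1 0 1)%N (hd1 0 2)%N (hd1 1 1)%N (hd2 0 1)%N (hd2 0 2)%N (hd2 1 1)%N.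
rewrite /bump /= !addnS !addn0.
set e0 := P * Q ^+ 0; set e1 := P * _; set e2 := P * _.
move=> hk.
pose Y := Q^-1.
have Y01 : 0 < Y < 1 by rewrite invr_gt0 invf_lt1; lra.
(* [M] collects the product terms and [D] the quotient terms weighted by the w_i; [M'] and [D'] are
   the same with the weights 1 / w_i, so Q becomes [Y]. *)
pose M := rho ^+ 2 * b j - rho * (1 + rho) * (1 + Q) * b j.+1
     + ((1 + rho) ^+ 2 * Q + rho * (1 + Q ^+ 2)) * b j.+2
     - (1 + rho) * (Q + Q ^+ 2) * b j.+3 + Q ^+ 2 * b j.+4.
pose M' := rho ^+ 2 * b j - rho * (1 + rho) * (1 + Y) * b j.+1
     + ((1 + rho) ^+ 2 * Y + rho * (1 + Y ^+ 2)) * b j.+2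
     - (1 + rho) * (Y + Y ^+ 2) * b j.+3 + Y ^+ 2 * b j.+4.
pose D' := rho * (1 + Y ^+ 2) * b 2%N - (1 + rho) * (1 + Y) * (rho + Y) * b 1%N.
have {hk} hk : 0 <= 2 * P * (M - D) + 2 * P^-1 * (M' - D').
  apply: le_trans hk _; rewrite le_eqVlt; apply/orP; left; apply/eqP.
  by rewrite /M /M' /D /D' /e0 /e1 /e2 /Y -/Q; field; rewrite Pn Qn.
have B m : b (j + m)%N <= 4 * P * q ^+ m by rewrite -mulrA -exprD.
have [Bj B2 B4] : [/\ b j <= 4 * P, b j.+2 <= 4 * P * q ^+ 2 & b j.+4 <= 4 * P * q ^+ 4].
  by split; [have := B 0%N|have := B 2%N|have := B 4%N]; rewrite ?addnS ?addn0 ?expr0 ?mulr1.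
have Bo : b 1%N <= 4 * P * q.
  by apply: le_trans (bC 1%N) _; rewrite expr1; nra.
move: Y01 => /andP[Y0 Y1]; have r0 : 0 < rho by lra.
have hMD : M' - D' <= 4 * P * K.
  have t1 : rho ^+ 2 * b j <= rho ^+ 2 * (4 * P) by rewrite ler_wpM2l// sqr_ge0.
  have t2 : 0 <= rho * (1 + rho) * (1 + Y) * b j.+1.
    by apply: mulr_ge0 => //; nra.
  have t3 : ((1 + rho) ^+ 2 * Y + rho * (1 + Y ^+ 2)) * b j.+2
     <= ((1 + rho) ^+ 2 + 2 * rho) * (4 * P * q ^+ 2).
    have Y2 : 0 <= Y ^+ 2 <= 1 by rewrite sqr_ge0 exprn_ile1; lra.
    have s1 : 0 <= (1 + rho) ^+ 2 by rewrite sqr_ge0.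
    apply: ler_pM => //; nra.
  have t4 : 0 <= (1 + rho) * (Y + Y ^+ 2) * b j.+3.
    by apply: mulr_ge0 => //; apply: mulr_ge0; rewrite ?expr2; nra.
  have t5 : Y ^+ 2 * b j.+4 <= 4 * P * q ^+ 4.
    by apply: le_trans B4; rewrite ler_piMl// exprn_ile1//; lra.
  have t6 : 0 <= rho * (1 + Y ^+ 2) * b 2%N.
    by apply: mulr_ge0 => //; apply: mulr_ge0; rewrite ?expr2; nra.
  have t7 : (1 + rho) * (1 + Y) * (rho + Y) * b 1%N <= 2 * (1 + rho) ^+ 2 * (4 * P * q).
    have u1 : 0 <= (1 + rho) * (1 + Y) by apply: mulr_ge0; lra.
    apply: ler_pM => //; first by apply: mulr_ge0 => //; lra.
    have -> : 2 * (1 + rho) ^+ 2 = ((1 + rho) * 2) * (1 + rho) by ring.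
    by apply: ler_pM => //; [lra|apply: ler_pM; lra|lra].
  by rewrite /M' /D' /K; lra.
change (D / 2 <= M).
have h1 : 0 <= P * (M - D) + 4 * K.
  have : P^-1 * (M' - D') <= 4 * K.
    by rewrite ler_pdivrMl//; lra.
  lra.
have : 8 * K < D * P by move: PK; rewrite ltr_pdivrMr// [ltRHS]mulrC.
move=> h2.
have : 0 <= P * (M - D / 2) by lra.
by rewrite pmulr_rge0// subr_ge0.
Qed.

(** The optimal value rho = q is itself excluded by the growth argument and is reached as a limit
    from the right. *)
Lemma hfun_doubling {R : realType} (phi G : R -> R) (q : R) :
  continuous phi -> (forall x : R, 0 < x -> is_derive x 1 G (phi x)) -> energy_pd phi ->
  phi 1 = 1 -> G 1 = 0 -> 1 < q ->
  (1 + q ^+ 2 ^+ 2) * hfun G (q ^+ 2 ^+ 2) <= (1 + q) ^+ 2 * (1 + q ^+ 2) * hfun G (q ^+ 2).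
Proof.
move=> pc dG pd phi1 G1 q1.
have qQ : q < q ^+ 2 by rewrite expr2; nra.
pose F (x : R) := (1 + x) * (1 + q ^+ 2) * (x + q ^+ 2) * hfun G (q ^+ 2)
   - x * ((1 + q ^+ 2 ^+ 2) * hfun G (q ^+ 2 ^+ 2)).
have Fc : (F x @[x --> q^'+] --> F q)%classic.
  apply: cvg_at_right_filter; rewrite /F.
  apply: cvgB; last by apply: cvgM; [exact: cvg_id|exact: cvg_cst].
  apply: cvgM; last exact: cvg_cst.
  apply: cvgM; last by apply: cvgD; [exact: cvg_id|exact: cvg_cst].
  by apply: cvgM; [apply: cvgD; [exact: cvg_cst|exact: cvg_id]|exact: cvg_cst].
have F0 : 0 <= F q.
  apply: (cvgr_to_ge Fc); near=> x.
  have := hfun_doubling_aux phi G q x pc dG pd phi1 G1 q1.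
  rewrite /F subr_ge0 mulrA; apply; near: x.
    exact: nbhs_right_gt.
  exact: nbhs_right_lt.
have q0 : 0 < q by lra.
rewrite -(ler_pM2l q0) -subr_ge0; apply: le_trans F0 _.
by rewrite le_eqVlt; apply/orP; left; apply/eqP; rewrite /F; ring.
Unshelve. all: by end_near. Qed.

(** * The sharp bound on H *)

Lemma antiderivative_near1 {R : realType} (phi G : R -> R) (d : R) :
  continuous phi -> (forall x : R, 0 < x -> is_derive x 1 G (phi x)) ->
  phi 1 = 1 -> G 1 = 0 -> 0 < d ->
  exists2 eta : R, 0 < eta & forall x, 0 <= x <= eta -> G (1 + x) <= (1 + d) * x.
Proof.
move=> pc dG phi1 G1 d0.
have /cvgrPdist_lt /(_ d d0) := pc 1.
move=> /nbhs_ballP[r /= r0 hr]; rewrite phi1 in hr.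
exists (r / 2); first by rewrite divr_gt0.
move=> x /andP[x0 xr].
have [->|xn0] := eqVneq x 0; first by rewrite addr0 G1 mulr0.
have x0' : 0 < x by rewrite lt_neqAle eq_sym xn0.
have x1 : 1 < 1 + x by rewrite ltrDl.
have [||c] := @MVT R G phi 1 (1 + x) x1.
- by move=> y; rewrite in_itv /= => /andP[y1 _]; apply: dG; lra.
- apply: derivable_within_continuous => y; rewrite in_itv /= => /andP[y1 _].
  have /dG h : 0 < y by lra.
  exact: ex_derive.
rewrite in_itv /= => /andP[c1 c2]; rewrite G1 subr0 => ->.
have -> : 1 + x - 1 = x by ring.
rewrite ler_wpM2r//.
have h1 : `|1 - phi c| < d.
  apply: hr; rewrite /ball/= ltr_norml; apply/andP; split.
    by move: c2; clear -xr r0; lra.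
  by move: c1; clear -r0; lra.
move: h1; rewrite ltr_norml => /andP[h1 h2]; lra.
Qed.

(** The constant 4 is 2 times 2: 1 + q^2 is close to 2, and cosh(2 log q) - 1 = (q^2 - 1)^2 / (2
    q^2) is close to 2 (q - 1)^2. *)
Lemma hfun_le_near1 {R : realType} (phi G : R -> R) (d : R) :
  continuous phi -> (forall x : R, 0 < x -> is_derive x 1 G (phi x)) ->
  phi 1 = 1 -> G 1 = 0 -> 0 < d <= 1 ->
  exists2 eta : R, 0 < eta & forall q, 1 < q -> q <= 1 + eta ->
    (1 + q ^+ 2) * hfun G (q ^+ 2) <= (4 + 8 * d) * (q - 1) ^+ 2.
Proof.
move=> pc dG phi1 G1 /andP[d0 d1].
have [e0 e00 he] := antiderivative_near1 phi G d pc dG phi1 G1 d0.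
(* The three bounds give (q - 1)^2 <= q - 1, then [x] at most [e0], then q^2 - 1 <= 3 (q - 1) <=
   d. *)
exists (Num.min 1 (Num.min (e0 / 2) (d / 3))).
  by rewrite !lt_min ltr01 !divr_gt0.
move=> q q1; rewrite -lerBlDl !le_min => /and3P[h1 h2 h3].
have q0 : 0 < q by lra.
pose x := (q - 1) ^+ 2 * ((q + 1) ^+ 2 / (2 * q ^+ 2)).
have hx : (q ^+ 2 + (q ^+ 2)^-1) / 2 = 1 + x.
  by rewrite /x; field; rewrite gt_eqF.
have k1 : 0 <= (q + 1) ^+ 2 / (2 * q ^+ 2) <= 2.
  have q2' : 0 < 2 * q ^+ 2 by rewrite mulr_gt0// exprn_gt0.
  apply/andP; split; first by rewrite divr_ge0 ?sqr_ge0// ltW.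
  by rewrite ler_pdivrMr// !expr2; nra.
set k := (q + 1) ^+ 2 / _ in x hx k1.
have s0 : 0 <= (q - 1) ^+ 2 by rewrite sqr_ge0.
have s1 : (q - 1) ^+ 2 <= q - 1 by rewrite expr2; nra.
have x0 : 0 <= x <= e0 by rewrite /x; apply/andP; split; nra.
have := he _ x0; rewrite /hfun hx => hG.
have x2 : x <= 2 * (q - 1) ^+ 2 by rewrite /x; nra.
have q2 : 1 + q ^+ 2 <= 2 + d.
  have -> : q ^+ 2 = 1 + 2 * (q - 1) + (q - 1) ^+ 2 by ring.
  lra.
have G0 : G (1 + x) <= (1 + d) * (2 * (q - 1) ^+ 2).
  by apply: le_trans hG _; apply: ler_wpM2l => //; lra.
have q20 : 0 <= 1 + q ^+ 2 by rewrite addr_ge0// sqr_ge0.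
apply: (@le_trans _ _ ((1 + q ^+ 2) * ((1 + d) * (2 * (q - 1) ^+ 2)))).
  exact: ler_wpM2l.
apply: (@le_trans _ _ ((2 + d) * ((1 + d) * (2 * (q - 1) ^+ 2)))).
  by apply: ler_wpM2r => //; apply: mulr_ge0; lra.
have -> : (2 + d) * ((1 + d) * (2 * (q - 1) ^+ 2)) = ((2 + d) * (1 + d) * 2) * (q - 1) ^+ 2 by ring.
by apply: ler_wpM2r => //; nra.
Qed.

(* For the extremal kernel equality holds; hfun_doubling compares s with its square
   root, which reduces the claim to s near 1. *)
Lemma hfun_le {R : realType} (phi G : R -> R) (s : R) :
  continuous phi -> (forall x : R, 0 < x -> is_derive x 1 G (phi x)) -> energy_pd phi ->
  phi 1 = 1 -> G 1 = 0 -> 1 < s ->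
  (1 + s ^+ 2) * hfun G (s ^+ 2) <= 4 * (s - 1) ^+ 2.
Proof.
move=> pc dG pd phi1 G1 s1.
have main d : 0 < d <= 1 -> (1 + s ^+ 2) * hfun G (s ^+ 2) <= (4 + 8 * d) * (s - 1) ^+ 2.
  move=> /(hfun_le_near1 phi G d pc dG phi1 G1)[eta eta0 h].
  have iter n : forall q, 1 < q -> q - 1 <= eta * 2 ^+ n ->
      (1 + q ^+ 2) * hfun G (q ^+ 2) <= (4 + 8 * d) * (q - 1) ^+ 2.
    elim: n => [|n IH] q q1 qn.
      by apply: h => //; move: qn; rewrite expr0 mulr1; lra.
    pose p := Num.sqrt q.
    have pq : p ^+ 2 = q by rewrite sqr_sqrtr//; lra.
    have p1 : 1 < p by rewrite -[ltLHS]sqrtr1 ltr_sqrt//; lra.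
    have hp : p - 1 <= eta * 2 ^+ n.
      (* q - 1 = (p - 1)(p + 1) >= 2 (p - 1): a square root at least halves the distance to 1. *)
      by move: qn; rewrite exprS -pq expr2; set z := 2 ^+ n; nra.
    have := IH p p1 hp.
    have := hfun_doubling phi G p pc dG pd phi1 G1 p1; rewrite !pq => h1 h2.
    apply: le_trans h1 _; rewrite -mulrA.
    apply: (@le_trans _ _ ((1 + p) ^+ 2 * ((4 + 8 * d) * (p - 1) ^+ 2))).
      by apply: ler_wpM2l => //; rewrite sqr_ge0.
    by rewrite -pq le_eqVlt; apply/orP; left; apply/eqP; ring.
  have [n hn] := expn_unbounded 2 ((s - 1) / eta) (ltr1n R 2).
  by apply: (iter n) => //; rewrite -ler_pdivrMl// mulrC ltW.
have Y0 : 0 < (s - 1) ^+ 2 by rewrite exprn_gt0// subr_gt0.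
apply/ler_addgt0Pr => e e0.
pose d := Num.min 1 (e / (8 * (s - 1) ^+ 2)).
have Y8 : 0 < 8 * (s - 1) ^+ 2 by rewrite mulr_gt0.
have d0 : 0 < d <= 1.
  apply/andP; split; first by rewrite lt_min ltr01 divr_gt0.
  by rewrite ge_min lexx.
apply: le_trans (main d d0) _; rewrite mulrDl lerD2l.
have : d <= e / (8 * (s - 1) ^+ 2) by rewrite /d ge_min lexx orbT.
by rewrite ler_pdivlMr ?mulr_gt0//; lra.
Qed.

(** * From H back to phi *)

(** With r^2 = (t - 1)(t + 1), Cauchy-Schwarz bounds (t - 1)(1 + t)^3 phi(t)^2 by 2 t G(t^2 + r^2),
    and [hfun_le] bounds this by 8 (t - 1). *)
Lemma energy_pd_le {R : realType} (phi : R -> R) (t : R) :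
  continuous phi -> energy_pd phi -> phi 1 = 1 -> 1 <= t ->
  (1 + t) ^+ 3 * phi t ^+ 2 <= 8.
Proof.
move=> pc pd phi1 t1.
have [->|tn1] := eqVneq t 1; first by rewrite phi1 expr1n mulr1; lra.
have {tn1} t1' : 1 < t by rewrite lt_neqAle eq_sym tn1.
have [G [G1 dG]] := exists_antiderivative phi pc.
pose r := Num.sqrt (t ^+ 2 - 1).
have t2 : 0 < t ^+ 2 - 1 by rewrite expr2; nra.
have r2 : r ^+ 2 = t ^+ 2 - 1 by rewrite sqr_sqrtr// ltW.
have r0 : 0 < r by rewrite sqrtr_gt0.
(* For t = cosh s this is e^s, so [w ^+ 2] has parameter 2s and cosh 2s = t^2 + r^2. *)
pose w := t + r; have w1 : 1 < w by rewrite /w; lra.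
have w0 : 0 < w by lra.
have wV : w^-1 = t - r.
  apply: (mulfI (lt0r_neq0 w0)); rewrite divff ?gt_eqF//.
  have -> : w * (t - r) = t ^+ 2 - r ^+ 2 by rewrite /w; ring.
  by rewrite r2; ring.
have wS : 1 + w ^+ 2 = 2 * t * w.
  have -> : 1 + w ^+ 2 = 1 + r ^+ 2 + t ^+ 2 + 2 * t * r by rewrite /w; ring.
  by rewrite r2 /w; ring.
have hw : hfun G (w ^+ 2) = G (t ^+ 2 + r ^+ 2).
  by rewrite /hfun -exprVn wV /w; congr G; field.
have hG : t * G (t ^+ 2 + r ^+ 2) <= 4 * (t - 1).
  have := hfun_le phi G w pc dG pd phi1 G1 w1; rewrite hw wS.
  have -> : (w - 1) ^+ 2 = 2 * w * (t - 1).
    have -> : (w - 1) ^+ 2 = 1 + w ^+ 2 - 2 * w by ring.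
    by rewrite wS; ring.
  move=> h; rewrite -(ler_pM2l (mulr_gt0 (ltr0Sn R 1) w0)).
  have -> : 2 * w * (t * G (t ^+ 2 + r ^+ 2)) = 2 * t * w * G (t ^+ 2 + r ^+ 2) by ring.
  by apply: le_trans h _; lra.
pose rr (i : 'I_2) : R := if i == ord0 then 0 else r.
pose e (i : 'I_2) : R := if i == ord0 then 1 else t.
(* A shell of radius 0 makes the averaged function constant; only the pair (r, r) calls for [G]. *)
pose J (i j : 'I_2) : R := if (i == ord0) || (j == ord0) then phi (e i * e j)
  else (G (t ^+ 2 + r ^+ 2) - G (t ^+ 2 - r ^+ 2)) / (2 * r ^+ 2).
have eE i : e i = Num.sqrt (1 + rr i ^+ 2).
  rewrite /e /rr; case: ifP => _; first by rewrite expr0n addr0 sqrtr1.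
  by rewrite r2 addrC subrK sqrtr_sqr gtr0_norm//; lra.
have hJ i j : ((fun N => sphere_avg N (fun z => phi (e i * e j - rr i * rr j * z)))
      @ \oo --> J i j)%classic.
  rewrite /J; have [ij|/norP[/negbTE i0 /negbTE j0]] := boolP ((i == ord0) || (j == ord0)).
    have rij : rr i * rr j = 0.
      by rewrite /rr; case/orP: ij => ->; rewrite ?mul0r ?mulr0.
    have := @cvg_sphere_avg R (cst (phi (e i * e j))) (fun z => phi (e i * e j) * z).
    rewrite mulr1 mulrN1 opprK -mulr2n -[_ *+ 2]mulr_natr mulfK ?pnatr_eq0// => h.
    apply: eq_cvg_seq; last first.
      apply: h; first by move=> ?; exact: cvg_cst.
      move=> x _; rewrite (_ : (fun z : R => _) = phi (e i * e j) *: id)//.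
      by apply: is_derive_eq; rewrite /GRing.scale /= mulr1.
    by move=> N /=; congr sphere_avg; apply/funext => z; rewrite rij mul0r subr0.
  rewrite /e /rr i0 j0 -!expr2; apply: cvg_sphere_avg_affine => //; first by rewrite exprn_gt0.
  by rewrite r2; lra.
have h := fun a => @energy_pd_shells R phi 2 rr e a J pd eE hJ.
have h2 : ((1 + t) * phi t) ^+ 2 <= 2 * (2 * t * (G (t ^+ 2 + r ^+ 2) / (2 * r ^+ 2))).
  apply: form2_det => // a b.
  have := h (fun i => if i == ord0 then a else b).
  rewrite !big_ord_recl !big_ord0 /J /e /= !mulr1 !mul1r phi1.
  have -> : t ^+ 2 - r ^+ 2 = 1 by rewrite r2; ring.
  rewrite G1 subr0 => hh; apply: le_trans hh _.
  by rewrite le_eqVlt; apply/orP; left; apply/eqP; ring.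
have r2n : r ^+ 2 != 0 by rewrite gt_eqF// exprn_gt0.
have h3 : r ^+ 2 * ((1 + t) * phi t) ^+ 2 <= 2 * (4 * (t - 1)).
  apply: (@le_trans _ _ (2 * (t * G (t ^+ 2 + r ^+ 2)))); last by rewrite ler_pM2l.
  have r20 : 0 < r ^+ 2 by rewrite exprn_gt0.
  apply: le_trans (ler_wpM2l (ltW r20) h2) _.
  by rewrite le_eqVlt; apply/orP; left; apply/eqP; field; rewrite gt_eqF.
have tm : 0 < t - 1 by lra.
rewrite -(ler_pM2l tm).
have -> : (t - 1) * ((1 + t) ^+ 3 * phi t ^+ 2) = r ^+ 2 * ((1 + t) * phi t) ^+ 2.
  by rewrite r2; ring.
by apply: le_trans h3 _; lra.
Qed.

(** Freezing the argument below 1 gives a function continuous on the whole line without changing it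
    on [1, +oo[. *)
Lemma continuous_extension {R : realType} (m : R) (g : R -> R) : 0 < m ->
  {within `[m ^+ 2, +oo[, continuous g}%classic ->
  continuous (fun t : R => g (m ^+ 2 * Num.max t 1)).
Proof.
move=> m0 /subspace_continuousP gc t.
pose psi (t : R) : R := m ^+ 2 * Num.max t 1.
have psi_in x : `[m ^+ 2, +oo[%classic (psi x).
  rewrite /= in_itv /= andbT /psi ler_peMr ?sqr_ge0//.
  by rewrite le_max lexx orbT.
have psic : {for t, continuous psi}.
  apply: cvgM; first exact: cvg_cst.
  by apply: (@continuous_max R R id (cst 1) t); [exact: cvg_id|exact: cvg_cst].
apply: (cvg_comp psi g _ (gc _ (psi_in t))) => U hU.
have : nbhs t [set x | `[m ^+ 2, +oo[%classic (psi x) -> U (psi x)]%classic := psic _ hU.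
by apply: filterS => x; apply; exact: psi_in.
Qed.

Theorem mainTheorem1 (R : realType) (m : R) (hm : 0 < m)
    (K : 'rV[R]_3 -> 'rV[R]_3 -> R[i]) (hK : causal_kernel m K)
    (k p : 'rV[R]_3) :
  `|K k p| <= (K32 m k p)%:C.
Proof.
case: hK => pdK [g [gc g1 KE]].
pose phi (t : R) := g (m ^+ 2 * Num.max t 1).
have phiE (t : R) : 1 <= t -> phi t = g (m ^+ 2 * t) by move=> t1; rewrite /phi max_l.
have pc : continuous phi by exact: continuous_extension.
have phi1 : phi 1 = 1 by rewrite phiE// mulr1.
have pd : energy_pd phi := causal_kernel_energy_pd m K g phi hm pdK KE phiE.
have mn : m != 0 by rewrite gt_eqF.
have kE x : x = m *: (m^-1 *: x) :> 'rV[R]_3 by rewrite scalerA divff// scale1r.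
rewrite KE /K32 (kE k) (kE p); move: (m^-1 *: k) (m^-1 *: p) => x y.
rewrite minkZ//; set t := _ - _; have t1 : 1 <= t := unit_mink_ge1 x y.
rewrite -phiE// normc_def /= expr0n addr0 sqrtr_sqr lecR normrM.
have f0 : 0 <= energy_factor m (m *: x) (m *: y).
  by rewrite divr_ge0 ?addr_ge0 ?mulr_ge0 ?sqrtr_ge0.
rewrite ger0_norm// ler_wpM2l//.
have -> : 2 * m ^+ 2 / (m ^+ 2 + m ^+ 2 * t) = 2 / (1 + t).
  have m20 : 0 < m ^+ 2 by rewrite exprn_gt0.
  by field; apply/andP; split; apply: lt0r_neq0; nra.
have a0 : 0 <= 2 / (1 + t) by rewrite divr_ge0//; lra.
(* Both sides are squared: the bound on phi^2 drops the absolute value, and the exponent 3/2 becomes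
   3. *)
rewrite -(@ler_pXn2r _ 2) ?nnegrE ?normr_ge0 ?powR_ge0//.
rewrite real_normK ?num_real// -[leRHS]powR_mulrn ?powR_ge0// -powRrM.
have -> : 3 / 2 * 2%:R = 3%:R :> R by field.
rewrite powR_mulrn// expr_div_n ler_pdivlMr ?exprn_gt0//; last by lra.
rewrite mulrC; apply: le_trans (energy_pd_le phi t pc pd phi1 t1) _.
by rewrite le_eqVlt; apply/orP; left; apply/eqP; ring.
Qed.
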